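(* Let $L$ be a frame. The following statements are equivalent. (1) The sum of every two $d$-ideals in $\mathcal{R}L$ is a $d$-ideal or all of $\mathcal{R}L$, and of any two ideals in $\mathcal{R}L$ whose sum is a proper $d$-ideal, at least one is a $d$-ideal. (2) $L$ is a $P_F$-frame. (3) Of any two ideals in $\mathcal{R}L$ whose intersection is a $d$-ideal, at least one is a $d$-ideal.
   Context: A frame is a complete lattice $L$ (top $1$, bottom $0$) satisfying $a\wedge\bigvee S=\bigvee\{a\wedge s\mid s\in S\}$ for all $a\in L$, $S\subseteq L$. Throughout, all frames are assumed completely regular: $a=\bigvee\{x\mid x\prec\!\prec a\}$ for all $a$, where $a\prec b$ means there is $t$ with $a\wedge t=0$, $t\vee b=1$, and $a\prec\!\prec b$ means there is a family $(c_q)_{q\in\mathbb{Q}\cap[0,1]}$ with $c_0=a$, $c_1=b$, $c_r\prec c_s$ for $r<s$. The pseudocomplement of $a$ is $a^*=\bigvee\{x\in L\mid x\wedge a=0\}$, and $a$ is complemented if $a\vee a^*=1$. $\mathcal{L}(\mathbb{R})$ is the frame of reals, generated by pairs $(p,q)$ of rationals subject to $(p,q)\wedge(r,s)=(p\vee r,q\wedge s)$; $(p,q)\vee(r,s)=(p,s)$ when $p\le r<q\le s$; $(p,q)=\bigvee\{(r,s)\mid p<r<s<q\}$; $1=\bigvee\{(p,q)\mid p,q\in\mathbb{Q}\}$. $\mathcal{R}L$ is the ring of real-valued continuous functions on $L$: the set of frame homomorphisms $\mathcal{L}(\mathbb{R})\to L$, a commutative ring with identity under $(\varphi\diamond\psi)(p,q)=\bigvee\{\varphi(r,s)\wedge\psi(t,u)\mid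 x\diamond y\in(p,q)\text{ for all rationals }x\in(r,s),\,y\in(t,u)\}$ for $\diamond\in\{+,\cdot\}$. For $\varphi\in\mathcal{R}L$, $\mathrm{coz}\,\varphi=\bigvee\{\varphi(p,0)\vee\varphi(0,q)\mid p,q\in\mathbb{Q}\}$, and $\mathrm{Coz}\,L=\{\mathrm{coz}\,\varphi\mid\varphi\in\mathcal{R}L\}$. $L$ is a $P_F$-frame if whenever $a,b\in\mathrm{Coz}\,L$ satisfy $a\wedge b=0$, at least one of $a,b$ is complemented. An ideal $I$ of $\mathcal{R}L$ is a $d$-ideal if for any $\alpha\in\mathcal{R}L$ and $f\in I$, $\mathrm{coz}\,\alpha\le(\mathrm{coz} f)^{**}$ implies $\alpha\in I$. *)

(* Defs.v *)
From HB Require Import structures.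
From mathcomp Require Import all_boot all_order all_algebra.
From mathcomp Require Import boolp classical_sets.
From mathcomp Require Import ring lra.
Set Implicit Arguments.
Unset Strict Implicit.
Unset Printing Implicit Defensive.
Import Order.TTheory GRing.Theory Num.Theory.

Local Open Scope classical_set_scope.
Local Open Scope ring_scope.
Local Open Scope order_scope.

(** * Frames *)

HB.mixin Record TBLattice_isFrame d T of Order.TBLattice d T := {
  bigjoin : set T -> T;
  bigjoin_supremums : forall S : set T, supremums S (bigjoin S);
  meet_bigjoin : forall (a : T) (S : set T),
    a `&` bigjoin S = bigjoin [set a `&` s | s in S]
}.

#[short(type="frameType")]
HB.structure Definition Frame d :=
  { T of TBLattice_isFrame d T & Order.TBLattice d T }.

Section FrameTheory.
Context {d : Order.disp_t} {L : frameType d}.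
Implicit Types (a b c : L) (S : set L).

Lemma bigjoin_ub S a : S a -> a <= bigjoin S.
Proof. by case: (bigjoin_supremums S) => ub _ Sa; apply: ub. Qed.

Lemma bigjoin_le S b : (forall a, S a -> a <= b) -> bigjoin S <= b.
Proof. by case: (bigjoin_supremums S) => _ lub Sb; apply: lub. Qed.

Lemma bigjoin_mono S (S' : set L) :
  (forall a, S a -> exists2 b, S' b & a <= b) -> bigjoin S <= bigjoin S'.
Proof.
move=> h; apply: bigjoin_le => a /h[b Sb ab].
exact: le_trans ab (bigjoin_ub Sb).
Qed.

Lemma meet_bigjoin_le a b S :
  (forall s, S s -> a `&` s <= b) -> a `&` bigjoin S <= b.
Proof. by move=> h; rewrite meet_bigjoin; apply: bigjoin_le => _ [s Ss <-]; apply: h. Qed.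

Lemma bigjoin0 : bigjoin (set0 : set L) = \bot.
Proof. by apply/eqP; rewrite -lex0; apply: bigjoin_le. Qed.

Lemma bigjoin2 a b : bigjoin [set a; b] = a `|` b.
Proof.
apply/le_anti/andP; split; first by apply: bigjoin_le => c [] ->; rewrite ?leUl ?leUr.
by rewrite leUx; apply/andP; split; apply: bigjoin_ub; [left|right].
Qed.

End FrameTheory.

Record frameHom {d d'} (M : frameType d) (L : frameType d') := FrameHom {
  frameHom_fun :> M -> L;
  frameHom_top : frameHom_fun \top = \top;
  frameHom_meet : forall a b : M,
    frameHom_fun (a `&` b) = frameHom_fun a `&` frameHom_fun b;
  frameHom_bigjoin : forall S : set M,
    frameHom_fun (bigjoin S) = bigjoin (frameHom_fun @` S)
}.

Section FrameHomTheory.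
Context {d d' : Order.disp_t} {M : frameType d} {L : frameType d'}.
Implicit Type f g : frameHom M L.

Lemma frameHom_ext f g : f =1 g -> f = g.
Proof.
case: f g => [f p1 p2 p3] [g q1 q2 q3] /= /funext fg; subst g.
by congr FrameHom; apply: Prop_irrelevance.
Qed.

Lemma frameHom_le f (a b : M) : a <= b -> f a <= f b.
Proof. by move=> /meet_idPl ab; apply/meet_idPl; rewrite -frameHom_meet ab. Qed.

Lemma frameHom_join f (a b : M) : f (a `|` b) = f a `|` f b.
Proof. by rewrite -!bigjoin2 frameHom_bigjoin image_setU !image_set1. Qed.

Lemma frameHom_bot f : f \bot = \bot.
Proof. by rewrite -!bigjoin0 frameHom_bigjoin image_set0. Qed.

End FrameHomTheory.

(** * The frame of reals *)

(* The frame presented by the generators [(p, q)] and the four relations is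
   built as the frame of sets of generators that are closed under the
   consequences of the relations; [rgen_meet], [rgen_join], [rgen_bigjoin],
   [rgen_top] and [rlift] below give the relations and the universal property. *)
Definition rsaturated (U : set (rat * rat)) : Prop :=
  [/\ forall p q r s : rat, U (p, q) -> p <= r -> s <= q -> U (r, s),
      forall p q r s : rat, p <= r -> r < q -> q <= s ->
        U (p, q) -> U (r, s) -> U (p, s)
    & forall p q : rat, (forall r s : rat, p < r -> r < s -> s < q -> U (r, s)) -> U (p, q)].

Record frame_of_reals := FrameOfReals {
  rset :> set (rat * rat);
  rsetP : rsaturated rset
}.

HB.instance Definition _ := gen_eqMixin frame_of_reals.
HB.instance Definition _ := gen_choiceMixin frame_of_reals.

Lemma rset_inj (U V : frame_of_reals) : rset U = rset V -> U = V.
Proof.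
case: U V => [U p] [V q] /= UV; subst V.
by congr FrameOfReals; apply: Prop_irrelevance.
Qed.

Definition rclosure (A : set (rat * rat)) : set (rat * rat) :=
  [set x | forall U, rsaturated U -> A `<=` U -> U x].

Lemma rclosureP A : rsaturated (rclosure A).
Proof.
split=> [p q r s cpq pr sq|p q r s pr rq qs c1 c2|p q h] U satU AU.
- by case: (satU) => h _ _; apply: h pr sq; apply: cpq.
- by case: (satU) => _ h _; apply: h pr rq qs _ _; [apply: c1|apply: c2].
- by case: (satU) => _ _ h'; apply: h' => r s pr rs sq; apply: h.
Qed.

Lemma sub_rclosure A : A `<=` rclosure A.
Proof. by move=> x Ax U _; apply. Qed.

Lemma rclosure_min A U : rsaturated U -> A `<=` U -> rclosure A `<=` U.
Proof. by move=> satU AU x; apply. Qed.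

Definition rspan A := FrameOfReals (rclosureP A).

Lemma rsaturatedI U V : rsaturated U -> rsaturated V -> rsaturated (U `&` V)%classic.
Proof.
move=> [u1 u2 u3] [v1 v2 v3]; split.
- by move=> p q r s [Up Vp] pr sq; split; [apply: u1 pr sq|apply: v1 pr sq].
- move=> p q r s pr rq qs [U1 V1] [U2 V2].
  by split; [apply: u2 pr rq qs _ _|apply: v2 pr rq qs _ _].
- by move=> p q h; split; [apply: u3|apply: v3] => r s pr rs sq; case: (h r s).
Qed.

Lemma rsaturatedT : rsaturated setT. Proof. by []. Qed.

Fact frame_of_reals_display : Order.disp_t. Proof. exact: Order.Disp tt tt. Qed.

Section FrameOfReals.
Implicit Types U V W : frame_of_reals.

Definition rle U V := `[< rset U `<=` rset V >].

Fact rle_refl : reflexive rle. Proof. by move=> U; apply/asboolP. Qed.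

Fact rle_anti : antisymmetric rle.
Proof.
move=> U V /andP[/asboolP UV /asboolP VU]; apply: rset_inj.
by apply/seteqP.
Qed.

Fact rle_trans : transitive rle.
Proof.
by move=> V U W /asboolP UV /asboolP VW; apply/asboolP; apply: subset_trans VW.
Qed.

HB.instance Definition _ := Order.Le_isPOrder.Build frame_of_reals_display
  frame_of_reals rle_refl rle_anti rle_trans.

Lemma rleP U V : reflect (rset U `<=` rset V) (U <= V).
Proof. exact: asboolP. Qed.

Definition rmeet U V := FrameOfReals (rsaturatedI (rsetP U) (rsetP V)).
Definition rjoin U V := rspan (rset U `|` rset V)%classic.

Fact rmeetP U V W : (U <= rmeet V W) = (U <= V) && (U <= W).
Proof.
apply/rleP/andP => [h|[/rleP h1 /rleP h2] x Ux]; last by split; [apply: h1|apply: h2].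
by split; apply/rleP => x /h[].
Qed.

Fact rjoinP U V W : (rjoin U V <= W) = (U <= W) && (V <= W).
Proof.
apply/rleP/andP => [h|[/rleP h1 /rleP h2]].
  by split; apply/rleP => x ?; apply: h; apply: sub_rclosure; [left|right].
by apply: rclosure_min; [apply: rsetP|move=> x []; [apply: h1|apply: h2]].
Qed.

HB.instance Definition _ := Order.POrder_MeetJoin_isLattice.Build
  frame_of_reals_display frame_of_reals rmeetP rjoinP.

Fact rle0x U : rspan set0 <= U.
Proof. by apply/rleP; apply: rclosure_min => //; apply: rsetP. Qed.

Fact rlex1 U : U <= FrameOfReals rsaturatedT.
Proof. by apply/rleP. Qed.

HB.instance Definition _ := Order.hasBottom.Build
  frame_of_reals_display frame_of_reals rle0x.
HB.instance Definition _ := Order.hasTop.Build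
  frame_of_reals_display frame_of_reals rlex1.

Definition rbigjoin (S : set frame_of_reals) := rspan [set x | exists2 U, S U & rset U x].

Fact rbigjoin_supremums S : supremums S (rbigjoin S).
Proof.
split=> [U SU|V ubV]; apply/rleP.
  by move=> x Ux; apply: sub_rclosure; exists U.
apply: rclosure_min; first exact: rsetP.
by move=> x [U /ubV/rleP UV /UV].
Qed.

(* Heyting implication of saturated sets, needed for distributivity only. *)
Lemma rsaturated_imp (U W : set (rat * rat)) : rsaturated U -> rsaturated W ->
  rsaturated [set x | forall y, U y ->
     W (Order.max x.1 y.1, Order.min x.2 y.2)].
Proof.
move=> [u1 u2 u3] [w1 w2 w3]; split => /=.
- move=> p q r s h pr sq [a b] /h /= Wab; apply: w1 Wab _ _.
    by rewrite ge_max !le_max pr lexx orbT.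
  by rewrite le_min !ge_min sq lexx orbT.
- move=> p q r s pr rq qs h1 h2 [a b] Uab /=.
  have /= W1 := h1 _ Uab; have /= W2 := h2 _ Uab.
  have [qa|aq] := leP q a.
    apply: w1 W2 _ _ => //.
    by rewrite (max_r (_ : r <= a)) ?le_max ?lexx ?orbT//; apply: le_trans qa; apply: ltW.
  have [br|rb] := leP b r.
    apply: w1 W1 _ _ => //.
    rewrite le_min; apply/andP; split; last by rewrite ge_min lexx orbT.
    by rewrite ge_min (le_trans br (ltW rq)) orbT.
  have [ba|ab] := leP b a.
    apply: w3 => r' s'; rewrite gt_max lt_min => /andP[_ h] h' /andP[_ h''].
    by exfalso; lra.
  apply: w2 W1 W2.
  + by rewrite ge_max !le_max pr lexx orbT.
  + by rewrite gt_max !lt_min rq aq rb ab.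
  + by rewrite le_min !ge_min qs lexx orbT.
- move=> p q h [a b] Uab /=; apply: w3 => r s.
  rewrite gt_max lt_min => /andP[pr ar] rs /andP[sq sb].
  have := h r s pr rs sq _ Uab; rewrite /= (max_l (ltW ar)) (min_l (ltW sb)).
  by [].
Qed.

Fact rmeet_bigjoin U (S : set frame_of_reals) :
  U `&` rbigjoin S = rbigjoin [set U `&` s | s in S].
Proof.
apply/le_anti/andP; split; last first.
  rewrite lexI; apply/andP; split; apply/rleP; apply: rclosure_min; try exact: rsetP.
    by move=> x [_ [V SV <-] [Ux _]].
  by move=> x [_ [V SV <-] [_ Vx]]; apply: sub_rclosure; exists V.
apply/rleP => -[p q] [Ux Jx].
set W := rbigjoin _.
have cl (V : frame_of_reals) a b c e :
    rset V (a, b) -> rset V (Order.max a c, Order.min b e).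
  by case: (rsetP V) => v1 _ _ /v1; apply; rewrite ?le_max ?ge_min lexx.
have /= := Jx _ (rsaturated_imp (rsetP U) (rsetP W)) _ _ Ux.
rewrite maxxx minxx; apply => -[a b] [V SV Vab] [a' b'] Uab /=.
apply: sub_rclosure; exists (U `&` V); first by exists V.
by split; [rewrite maxC minC|]; apply: cl.
Qed.

HB.instance Definition _ := TBLattice_isFrame.Build
  frame_of_reals_display frame_of_reals rbigjoin_supremums rmeet_bigjoin.

End FrameOfReals.

Definition rgen (p q : rat) : frame_of_reals := rspan [set (p, q)].

Lemma rgenE p q r s : rset (rgen p q) (r, s) <-> s <= r \/ (p <= r /\ s <= q).
Proof.
split.
  pose A : set (rat * rat) := [set x | x.2 <= x.1 \/ (p <= x.1 /\ x.2 <= q)].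
  apply: (rclosure_min (U := A)); last by move=> _ -> /=; right.
  split=> [a b c e|a b c e|a b h]; rewrite /A /=; try lra.
  have [ba|ab] := leP b a; [by left|right].
  have k r' s' : a < r' -> r' < s' -> s' < b -> p <= r' /\ s' <= q.
    by move=> ar rs sb; case: (h r' s' ar rs sb) => //=; lra.
  split; rewrite leNgt; apply/negP => h'.
    have [pb|bp] := leP p b.
      by have [|||k1 k2] := k ((2 * a + p) / 3) ((a + 2 * p) / 3); lra.
    by have [|||k1 k2] := k ((2 * a + b) / 3) ((a + 2 * b) / 3); lra.
  have [aq|qa] := leP a q.
    by have [|||k1 k2] := k ((2 * q + b) / 3) ((q + 2 * b) / 3); lra.
  by have [|||k1 k2] := k ((2 * a + b) / 3) ((a + 2 * b) / 3); lra.
case: (rsetP (rgen p q)) => h1 _ h3 [sr|[pr sq]].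
  by apply: h3 => r' s' rr rs ss; exfalso; lra.
by apply: h1 pr sq; apply: sub_rclosure.
Qed.

Lemma rgen_le p q (U : frame_of_reals) : (rgen p q <= U) = `[< rset U (p, q) >].
Proof.
apply/rleP/asboolP => [h|h]; first by apply: h; apply: sub_rclosure.
by apply: rclosure_min; [apply: rsetP|move=> _ ->].
Qed.

Lemma rgen_sub p q r s : r <= p -> q <= s -> rgen p q <= rgen r s.
Proof.
move=> rp qs; rewrite rgen_le; apply/asboolP.
by case: (rsetP (rgen r s)) => h _ _; apply: h rp qs; apply: sub_rclosure.
Qed.

Lemma rgen_span (U : frame_of_reals) :
  U = bigjoin [set V | exists p q, rset U (p, q) /\ V = rgen p q].
Proof.
apply/le_anti/andP; split.
  apply/rleP => -[p q] Upq; apply: sub_rclosure; exists (rgen p q).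
    by exists p, q.
  exact: sub_rclosure.
by apply: bigjoin_le => _ [p [q [Upq ->]]]; rewrite rgen_le; apply/asboolP.
Qed.

Lemma rgen_meet p q r s :
  rgen p q `&` rgen r s = rgen (Order.max p r) (Order.min q s).
Proof.
apply: rset_inj; apply/seteqP; split=> -[a b].
  move=> [/rgenE h1 /rgenE h2]; apply/rgenE; rewrite ge_max le_min.
  case: h1 h2 => [|[-> ->]]; first by left.
  by case=> [|[-> ->]]; [left|right].
move=> /rgenE; rewrite ge_max le_min => h; split; apply/rgenE.
  by case: h => [|[/andP[? _] /andP[? _]]]; [left|right].
by case: h => [|[/andP[_ ?] /andP[_ ?]]]; [left|right].
Qed.

Lemma rgen_join p q r s : p <= r -> r < q -> q <= s ->
  rgen p q `|` rgen r s = rgen p s.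
Proof.
move=> pr rq qs; apply/le_anti/andP; split.
  by rewrite leUx; apply/andP; split; apply: rgen_sub.
rewrite rgen_le; apply/asboolP; case: (rsetP (rgen p q `|` rgen r s)) => _ h _.
by apply: h pr rq qs _ _; apply: sub_rclosure; [left|right]; apply: sub_rclosure.
Qed.

Lemma rgen_bigjoin p q :
  rgen p q = bigjoin [set U | exists r s : rat, [/\ p < r, r < s, s < q & U = rgen r s]].
Proof.
apply/le_anti/andP; split; last first.
  by apply: bigjoin_le => _ [r [s [pr _ sq ->]]]; apply: rgen_sub; apply: ltW.
set W := bigjoin _; rewrite rgen_le; apply/asboolP.
case: (rsetP W) => _ _; apply=> r s pr rs sq.
by apply: sub_rclosure; exists (rgen r s); [exists r, s|apply: sub_rclosure].
Qed.

Lemma rgen_top : \top = bigjoin [set U | exists p q, U = rgen p q].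
Proof.
apply/le_anti/andP; split; last exact: lex1.
apply/rleP => -[p q] _; apply: sub_rclosure.
by exists (rgen p q); [exists p, q|apply: sub_rclosure].
Qed.

Lemma frameHom_rgen_ext {d} {L : frameType d} (f g : frameHom frame_of_reals L) :
  (forall p q, f (rgen p q) = g (rgen p q)) -> f = g.
Proof.
move=> fg; apply: frameHom_ext => U; rewrite (rgen_span U) !frameHom_bigjoin.
by congr bigjoin; apply: eq_imagel => _ [p [q [_ ->]]].
Qed.

(* Maps on the generators that turn the four relations into identities. *)
Definition real_relations {d} {L : frameType d} (g : rat -> rat -> L) : Prop :=
  [/\ forall p q r s : rat, g p q `&` g r s = g (Order.max p r) (Order.min q s),
      forall p q r s : rat, p <= r -> r < q -> q <= s -> g p q `|` g r s = g p s,
      forall p q : rat, g p q =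
        bigjoin [set a | exists r s : rat, [/\ p < r, r < s, s < q & a = g r s]]
    & \top = bigjoin [set a | exists p q : rat, a = g p q]].

Section Lift.
Context {d : Order.disp_t} {L : frameType d} (g : rat -> rat -> L).
Hypothesis g_rel : real_relations g.

Let g1 x : L := g x.1 x.2.

Definition rlift_fun (U : frame_of_reals) : L := bigjoin (g1 @` rset U).

Let gle p q r s : r <= p -> q <= s -> g p q <= g r s.
Proof.
case: g_rel => h _ _ _ rp qs; apply/meet_idPl.
by rewrite h (max_l rp) (min_l qs).
Qed.

Let rsat_le a : rsaturated [set x | g1 x <= a].
Proof.
case: g_rel => r1 r2 r3 r4; rewrite /g1; split=> /=.
- by move=> p q r s h pr sq; apply: le_trans h; apply: gle.
- by move=> p q r s pr rq qs h1 h2; rewrite -(r2 p q r s)// leUx h1.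
- by move=> p q h; rewrite r3; apply: bigjoin_le => _ [r [s [pr rs sq ->]]]; apply: h.
Qed.

Let rclosure_le A a : (forall x, A x -> g1 x <= a) ->
  forall x, rclosure A x -> g1 x <= a.
Proof. by move=> h x /(_ _ (rsat_le a)); apply. Qed.

Fact rlift_rgen p q : rlift_fun (rgen p q) = g p q.
Proof.
apply/le_anti/andP; split.
  apply: bigjoin_le => _ [x Ux <-]; move: x Ux.
  by apply: rclosure_le => _ ->.
by apply: bigjoin_ub; exists (p, q) => //; apply: sub_rclosure.
Qed.

Fact rlift_top : rlift_fun \top = \top.
Proof.
case: g_rel => _ _ _ ->; congr bigjoin; apply/seteqP; split=> [_ [[p q] _ <-]|_ [p [q ->]]].
  by exists p, q.
by exists (p, q).
Qed.

Fact rlift_meet U V : rlift_fun (U `&` V) = rlift_fun U `&` rlift_fun V.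
Proof.
apply/le_anti/andP; split.
  by rewrite lexI; apply/andP; split; apply: bigjoin_mono => _ [x [Ux Vx] <-];
     exists (g1 x) => //; exists x.
apply: meet_bigjoin_le => _ [[r s] Vx <-]; rewrite meetC.
apply: meet_bigjoin_le => _ [[p q] Ux <-]; rewrite meetC.
case: g_rel => -> _ _ _; apply: bigjoin_ub.
exists (Order.max p r, Order.min q s) => //; split.
  by case: (rsetP U) => h _ _; apply: h Ux _ _; rewrite ?le_max ?ge_min lexx.
by case: (rsetP V) => h _ _; apply: h Vx _ _; rewrite ?le_max ?ge_min lexx orbT.
Qed.

Fact rlift_bigjoin S : rlift_fun (bigjoin S) = bigjoin (rlift_fun @` S).
Proof.
apply/le_anti/andP; split.
  apply: bigjoin_le => _ [x Ux <-]; move: x Ux; apply: rclosure_le => x [U SU Ux].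
  apply: (@le_trans _ _ (rlift_fun U)); apply: bigjoin_ub; first by exists x.
  by exists U.
apply: bigjoin_le => _ [U SU <-]; apply: bigjoin_mono => _ [x Ux <-].
by exists (g1 x) => //; exists x => //; apply: sub_rclosure; exists U.
Qed.

Definition rlift : frameHom frame_of_reals L :=
  FrameHom rlift_top rlift_meet rlift_bigjoin.

Lemma rliftE p q : rlift (rgen p q) = g p q. Proof. exact: rlift_rgen. Qed.

End Lift.

Lemma frameHom_relations {d} {L : frameType d} (f : frameHom frame_of_reals L) :
  real_relations (fun p q => f (rgen p q)).
Proof.
split.
- by move=> p q r s; rewrite -frameHom_meet rgen_meet.
- by move=> p q r s pr rq qs; rewrite -frameHom_join rgen_join.
- move=> p q; rewrite rgen_bigjoin frameHom_bigjoin; congr bigjoin.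
  apply/seteqP; split=> [_ [_ [r [s [h1 h2 h3 ->]]] <-]|_ [r [s [h1 h2 h3 ->]]]].
    by exists r, s.
  by exists (rgen r s) => //; exists r, s.
- rewrite -(frameHom_top f) rgen_top frameHom_bigjoin; congr bigjoin.
  apply/seteqP; split=> [_ [_ [p [q ->]] <-]|_ [p [q ->]]]; first by exists p, q.
  by exists (rgen p q) => //; exists p, q.
Qed.

(** * The ring of real-valued continuous functions on a frame *)

Definition contfun {d} (L : frameType d) := frameHom frame_of_reals L.

HB.instance Definition _ d (L : frameType d) := gen_eqMixin (contfun L).
HB.instance Definition _ d (L : frameType d) := gen_choiceMixin (contfun L).

Section ContfunTheory.
Context {d : Order.disp_t} {L : frameType d}.
Implicit Types (phi psi : contfun L).

Lemma contfun_meet phi p q r s :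
  phi (rgen p q) `&` phi (rgen r s) = phi (rgen (Order.max p r) (Order.min q s)).
Proof. by rewrite -frameHom_meet rgen_meet. Qed.

Lemma contfun_le phi p q r s : r <= p -> q <= s -> phi (rgen p q) <= phi (rgen r s).
Proof. by move=> rp qs; apply/frameHom_le/rgen_sub. Qed.

Lemma contfun_join phi p q r s : p <= r -> r < q -> q <= s ->
  phi (rgen p s) <= phi (rgen p q) `|` phi (rgen r s).
Proof. by move=> pr rq qs; rewrite -frameHom_join rgen_join. Qed.

Lemma contfun_inner phi p q a b :
  (forall r s : rat, p < r -> r < s -> s < q -> a `&` phi (rgen r s) <= b) ->
  a `&` phi (rgen p q) <= b.
Proof.
case: (frameHom_relations phi) => _ _ h _ k; rewrite h.
by apply: meet_bigjoin_le => _ [r [s [pr rs sq ->]]]; apply: k.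
Qed.

Lemma contfun_cover phi a b :
  (forall p q : rat, a `&` phi (rgen p q) <= b) -> a <= b.
Proof.
case: (frameHom_relations phi) => _ _ _ h k; rewrite -[a]meetx1 h.
by apply: meet_bigjoin_le => _ [p [q ->]].
Qed.

Lemma contfun_empty phi p q : q <= p -> phi (rgen p q) = \bot.
Proof.
move=> qp; apply/eqP; rewrite -lex0 -[leLHS]meet1x; apply: contfun_inner.
by move=> r s pr rs sq; exfalso; lra.
Qed.

Lemma contfun_small phi (e : rat) a b : 0%R < e ->
  (forall p q : rat, q - p < e -> a `&` phi (rgen p q) <= b) -> a <= b.
Proof.
move=> e0 h; apply: (contfun_cover (phi := phi)) => p q.
pose t := e / 3.
have t0 : 0%R < t by rewrite /t; lra.
have step n : a `&` phi (rgen p (p + t * n%:R)) <= b.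
  elim: n => [|n IH].
    by rewrite mulr0 addr0 contfun_empty// meetx0 le0x.
  rewrite -natr1.
  have : phi (rgen p (p + t * (n%:R + 1))) <=
      phi (rgen p (p + t * n%:R)) `|` phi (rgen (p + t * n%:R - t) (p + t * (n%:R + 1))).
    have [n0|n0] := leP (p + t * n%:R - t) p.
      by apply: lexUr => //; apply: contfun_le.
    by apply: contfun_join; lra.
  move=> k; apply: le_trans (leI2 (lexx a) k) _.
  rewrite -bigjoin2; apply: meet_bigjoin_le => _ [] ->//.
  by apply: h; rewrite /t; lra.
pose n := Num.bound `|(q - p) / t|%R.
apply: le_trans (step n); apply: leI2 => //; apply: contfun_le => //.
have : (q - p) / t < n%:R by apply: le_lt_trans (ler_norm _) _; apply: archi_boundP; apply: normr_ge0.
by rewrite ltr_pdivrMr//; lra.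
Qed.

Lemma contfun_eq phi psi :
  (forall p q r s : rat, q <= r ->
     phi (rgen p q) `&` psi (rgen r s) <= \bot /\
     psi (rgen p q) `&` phi (rgen r s) <= \bot) -> phi = psi.
Proof.
have main (f g : contfun L) : (forall p q r s : rat, q <= r ->
     f (rgen p q) `&` g (rgen r s) <= \bot /\
     g (rgen p q) `&` f (rgen r s) <= \bot) ->
   forall p q, f (rgen p q) <= g (rgen p q).
  move=> h p q; rewrite -[leLHS]meet1x; apply: contfun_inner => p' q' pp' _ q'q.
  have e0 : 0%R < Order.min (p' - p) (q - q') by rewrite lt_min; apply/andP; split; lra.
  rewrite meet1x; apply: (contfun_small (phi := g) e0) => x y.
  rewrite lt_min => /andP[xy1 xy2].
  have [yp|py] := leP y p'.
    by rewrite meetC; apply: le_trans (proj2 (h _ _ _ _ yp)) (le0x _).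
  have [qx|xq] := leP q' x.
    by apply: le_trans (proj1 (h _ _ _ _ qx)) (le0x _).
  by apply: leIxr; apply: contfun_le; lra.
move=> h; apply: frameHom_rgen_ext => p q; apply/le_anti.
by rewrite !main// => p' q' r s qr; split; case: (h p' q' r s qr).
Qed.

End ContfunTheory.

Section Operations.
Context {d : Order.disp_t} {L : frameType d}.
Implicit Types (phi psi : contfun L) (f : rat -> rat -> rat).

Definition box_sub f (r s t u p q : rat) : Prop :=
  forall x y : rat, r < x < s -> t < y < u -> p < f x y < q.

Definition contfun_op f phi psi (p q : rat) : L :=
  bigjoin [set a | exists r s t u : rat,
    box_sub f r s t u p q /\ a = phi (rgen r s) `&` psi (rgen t u)].

Record good_op f : Prop := GoodOp {
  op_bounded : forall r s t u, exists p q, box_sub f r s t u p q;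
  op_unif : forall r s t u e : rat, 0%R < e -> exists2 c : rat, 0%R < c &
    forall x x' y y' : rat, r < x < s -> r < x' < s -> t < y < u -> t < y' < u ->
      `|x - x'|%R < c -> `|y - y'|%R < c -> f x y < f x' y' + e;
  op_btwl : forall a b x y m : rat, a < x < b ->
    (m <= f a y -> m <= f b y -> m <= f x y) /\
    (f a y <= m -> f b y <= m -> f x y <= m);
  op_btwr : forall a b x y m : rat, a < x < b ->
    (m <= f y a -> m <= f y b -> m <= f y x) /\
    (f y a <= m -> f y b <= m -> f y x <= m)
}.

Lemma op_shrink f r s t u r' s' t' u' p q : good_op f ->
  r < r' -> r' < s' -> s' < s -> t < t' -> t' < u' -> u' < u ->
  box_sub f r s t u p q ->
  exists p' q', [/\ p < p', p' < q', q' < q & box_sub f r' s' t' u' p' q'].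
Proof.
move=> gf h1 h2 h3 h4 h5 h6 bf.
have inx x : r' <= x <= s' -> r < x < s by move=> /andP[? ?]; apply/andP; split; lra.
have iny x : t' <= x <= u' -> t < x < u by move=> /andP[? ?]; apply/andP; split; lra.
have /andP[a1 b1] := bf r' t' (inx r' ltac:(by rewrite lexx ltW)) (iny t' ltac:(by rewrite lexx ltW)).
have /andP[a2 b2] := bf r' u' (inx r' ltac:(by rewrite lexx ltW)) (iny u' ltac:(by rewrite lexx ltW)).
have /andP[a3 b3] := bf s' t' (inx s' ltac:(by rewrite lexx ltW)) (iny t' ltac:(by rewrite lexx ltW)).
have /andP[a4 b4] := bf s' u' (inx s' ltac:(by rewrite lexx ltW)) (iny u' ltac:(by rewrite lexx ltW)).
pose m := Order.min (Order.min (f r' t') (f r' u')) (Order.min (f s' t') (f s' u')).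
pose M := Order.max (Order.max (f r' t') (f r' u')) (Order.max (f s' t') (f s' u')).
have pm : p < m by rewrite !lt_min a1 a2 a3 a4.
have Mq : M < q by rewrite !gt_max b1 b2 b3 b4.
have [m1 m2 m3 m4] : [/\ m <= f r' t', m <= f r' u', m <= f s' t' & m <= f s' u'].
  by rewrite /m; split; rewrite !ge_min lexx ?orbT.
have [M1 M2 M3 M4] : [/\ f r' t' <= M, f r' u' <= M, f s' t' <= M & f s' u' <= M].
  by rewrite /M; split; rewrite !le_max lexx ?orbT.
exists ((p + m) / 2), ((M + q) / 2); split; try lra.
move=> x y xx yy.
have [k1 k1'] := op_btwl gf t' m xx; have [_ k1''] := op_btwl gf t' M xx.
have [k2 k2'] := op_btwl gf u' m xx; have [_ k2''] := op_btwl gf u' M xx.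
have [k3 _] := op_btwr gf x m yy; have [_ k3'] := op_btwr gf x M yy.
have := k3 (k1 m1 m3) (k2 m2 m4); have := k3' (k1'' M1 M3) (k2'' M2 M4).
by move=> ? ?; apply/andP; split; lra.
Qed.

Lemma contfun_op_ub f phi psi r s t u p q : box_sub f r s t u p q ->
  phi (rgen r s) `&` psi (rgen t u) <= contfun_op f phi psi p q.
Proof. by move=> h; apply: bigjoin_ub; exists r, s, t, u. Qed.

Lemma contfun_op_le f phi psi p q a b :
  (forall r s t u, box_sub f r s t u p q ->
    a `&` (phi (rgen r s) `&` psi (rgen t u)) <= b) ->
  a `&` contfun_op f phi psi p q <= b.
Proof. by move=> h; apply: meet_bigjoin_le => _ [r [s [t [u [bf ->]]]]]; apply: h. Qed.

Lemma contfun_op_sub f phi psi p q r s : r <= p -> q <= s ->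
  contfun_op f phi psi p q <= contfun_op f phi psi r s.
Proof.
move=> rp qs; rewrite -[leLHS]meet1x; apply: contfun_op_le => r' s' t u bf.
rewrite meet1x; apply: contfun_op_ub => x y xx yy.
by have /andP[h1 h2] := bf x y xx yy; rewrite (le_lt_trans rp h1) (lt_le_trans h2 qs).
Qed.

Lemma contfun_op_relations f phi psi : good_op f -> real_relations (contfun_op f phi psi).
Proof.
move=> gf; split.
- move=> p q r s; apply/le_anti/andP; split; last first.
    by rewrite lexI !contfun_op_sub ?le_max ?ge_min ?lexx ?orbT.
  apply: contfun_op_le => r1 s1 t1 u1 b1; rewrite meetC.
  apply: contfun_op_le => r2 s2 t2 u2 b2; rewrite meetACA !contfun_meet.
  apply: contfun_op_ub => x y.
  rewrite !gt_max !lt_min => /andP[/andP[x1 x2] /andP[x3 x4]] /andP[/andP[y1 y2] /andP[y3 y4]].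
  have /andP[-> ->] := b1 x y ltac:(by rewrite x1 x3) ltac:(by rewrite y1 y3).
  by have /andP[-> ->] := b2 x y ltac:(by rewrite x2 x4) ltac:(by rewrite y2 y4).
- move=> p q r s pr rq qs; apply/le_anti/andP; split.
    by rewrite leUx !contfun_op_sub.
  rewrite -[leLHS]meet1x; apply: contfun_op_le => a b c e bf; rewrite meet1x.
  have [k k0 hk] := op_unif gf a b c e (e := q - r) ltac:(by rewrite subr_gt0).
  apply: (contfun_small (phi := phi) k0) => a1 b1 ab1.
  apply: (contfun_small (phi := psi) k0) => c1 e1 ce1.
  rewrite -meetA meetACA !contfun_meet.
  set A := Order.max a a1; set B := Order.min b b1.
  set C := Order.max c c1; set E := Order.min e e1.
  have inx x : A < x < B -> [/\ a < x < b & a1 < x < b1].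
    by rewrite gt_max lt_min => /andP[/andP[-> ->] /andP[-> ->]].
  have iny x : C < x < E -> [/\ c < x < e & c1 < x < e1].
    by rewrite gt_max lt_min => /andP[/andP[-> ->] /andP[-> ->]].
  have [hb|hb] := pselect (box_sub f A B C E p q).
    by apply: lexUl; apply: contfun_op_ub.
  apply: lexUr; apply: contfun_op_ub => x y xx yy.
  have [X X1] := inx _ xx; have [Y Y1] := iny _ yy.
  have /andP[_ ->] := bf _ _ X Y; rewrite andbT ltNge; apply/negP => fr.
  apply: hb => x' y' xx' yy'.
  have [X' X1'] := inx _ xx'; have [Y' Y1'] := iny _ yy'.
  have /andP[-> _] /= := bf _ _ X' Y'.
  have := hk x' x y' y X' X Y' Y.
  move: X1 X1' Y1 Y1' => /andP[? ?] /andP[? ?] /andP[? ?] /andP[? ?].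
  move=> h; have : f x' y' < f x y + (q - r).
    by apply: h; rewrite ltr_norml; apply/andP; split; lra.
  by lra.
- move=> p q; apply/le_anti/andP; split; last first.
    by apply: bigjoin_le => _ [r [s [pr _ sq ->]]]; apply: contfun_op_sub; apply: ltW.
  rewrite -[leLHS]meet1x; apply: contfun_op_le => r s t u bf; rewrite meet1x.
  apply: contfun_inner => t' u' h1 h2 h3; rewrite meetC.
  apply: contfun_inner => r' s' h4 h5 h6; rewrite meetC.
  have [p' [q' [pp' pq' qq' bf']]] := op_shrink gf h4 h5 h6 h1 h2 h3 bf.
  apply: le_trans (contfun_op_ub _ _ bf') _.
  by apply: bigjoin_ub; exists p', q'.
- apply/le_anti/andP; split; last exact: lex1.
  apply: (contfun_cover (phi := phi)) => r s; apply: (contfun_cover (phi := psi)) => t u.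
  have [p [q bf]] := op_bounded gf r s t u.
  rewrite meet1x; apply: le_trans (contfun_op_ub _ _ bf) _.
  by apply: bigjoin_ub; exists p, q.
Qed.

Definition contfun_cst_fun (c p q : rat) : L := if p < c < q then \top else \bot.

Lemma contfun_cst_relations c : real_relations (contfun_cst_fun c).
Proof.
rewrite /contfun_cst_fun; split.
- move=> p q r s; rewrite gt_max lt_min.
  by case: (p < c); case: (r < c); case: (c < q); case: (c < s);
    rewrite /= ?meet1x ?meetx1 ?meet0x ?meetx0.
- move=> p q r s pr rq qs; have [/andP[pc cs]|/negP pcs] := boolP (p < c < s).
    have [cq|qc] := ltP c q; first by rewrite pc /= join1x.
    by rewrite (lt_le_trans rq qc) cs /= joinx1.
  rewrite !ifN ?joinxx//; apply/negP => /andP[h1 h2]; apply: pcs; apply/andP; split; lra.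
- move=> p q; apply/le_anti/andP; split; last first.
    apply: bigjoin_le => _ [r [s [pr _ sq ->]]].
    case: ifP => // /andP[rc cs]; rewrite (lt_trans pr rc) (lt_trans cs sq).
    exact: lexx.
  case: ifP => [/andP[pc cq]|_]; last exact: le0x.
  apply: bigjoin_ub; exists ((p + c) / 2), ((c + q) / 2).
  split; [lra|lra|lra|].
  by rewrite ifT//; apply/andP; split; lra.
- apply/le_anti/andP; split; last exact: lex1.
  apply: bigjoin_ub; exists (c - 1)%R, (c + 1)%R.
  by rewrite ifT//; apply/andP; split; lra.
Qed.

Lemma good_add : good_op +%R.
Proof.
split.
- move=> r s t u; exists (r + t), (s + u) => x y /andP[? ?] /andP[? ?].
  by apply/andP; split; lra.
- move=> r s t u e e0; exists (e / 2); first by lra.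
  move=> x x' y y' _ _ _ _; rewrite !ltr_norml => /andP[? ?] /andP[? ?]; lra.
- by move=> a b x y m /andP[? ?]; split; lra.
- by move=> a b x y m /andP[? ?]; split; lra.
Qed.

Lemma good_mul : good_op *%R.
Proof.
have bnd r s t u : exists2 M : rat, (0 < M)%R & forall x y,
    r < x < s -> t < y < u -> `|x|%R <= M /\ `|y|%R <= M.
  exists (1 + `|r| + `|s| + `|t| + `|u|)%R.
    by rewrite -!addrA ltr_pwDl// !addr_ge0.
  move=> x y /andP[? ?] /andP[? ?]; rewrite !ler_norml.
  have := ler_norm r; have := ler_norm s; have := ler_norm t; have := ler_norm u.
  have := ler_norm (- r); have := ler_norm (- s).
  have := ler_norm (- t); have := ler_norm (- u); rewrite !normrN => *.
  by split; apply/andP; split; lra.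
have btw : forall a b x y m : rat, a < x < b ->
    (m <= a * y -> m <= b * y -> m <= x * y) /\
    (a * y <= m -> b * y <= m -> x * y <= m).
  move=> a b x y m /andP[ax xb].
  have [y0|y0] := leP 0%R y.
    by split => h1 h2; nra.
  by split => h1 h2; nra.
split=> //.
- move=> r s t u; have [M M0 hM] := bnd r s t u.
  exists (- (M * M) - 1)%R, (M * M + 1)%R => x y /hM k /k[xM yM].
  have : (`|x * y| <= M * M)%R by rewrite normrM ler_pM.
  by rewrite ler_norml => /andP[? ?]; apply/andP; split; lra.
- move=> r s t u e e0; have [M M0 hM] := bnd r s t u.
  exists (e / (3 * M))%R; first by rewrite divr_gt0// mulr_gt0.
  move=> x x' y y' xx xx' yy yy' h1 h2.
  have [xM _] := hM _ _ xx yy; have [_ yM'] := hM _ _ xx yy'.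
  have k1 : (`|x * (y - y')| <= M * (e / (3 * M)))%R by rewrite normrM ler_pM// ltW.
  have k2 : (`|y' * (x - x')| <= M * (e / (3 * M)))%R by rewrite normrM ler_pM// ltW.
  have ME : (M * (e / (3 * M)) = e / 3)%R by field; rewrite gt_eqF.
  by move: k1 k2; rewrite ME !ler_norml => /andP[? ?] /andP[? ?]; lra.
- by move=> a b x y m; rewrite ![(y * _)%R]mulrC; apply: btw.
Qed.

Definition contfun_add phi psi : contfun L := rlift (contfun_op_relations phi psi good_add).
Definition contfun_mul phi psi : contfun L := rlift (contfun_op_relations phi psi good_mul).
Definition contfun_cst c : contfun L := rlift (contfun_cst_relations c).

(* [alpha] is bounded by the pointwise function [F] of [f1], [f2], [f3], in the
   sense of the formula defining the operations; this determines [alpha]. *)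
Definition represents (f1 f2 f3 : contfun L) (F : rat -> rat -> rat -> rat)
    (alpha : contfun L) : Prop :=
  forall (p q : rat) (a b : L),
  (forall r1 s1 r2 s2 r3 s3 : rat,
    (forall x y z : rat, r1 < x < s1 -> r2 < y < s2 -> r3 < z < s3 -> p < F x y z < q) ->
    a `&` (f1 (rgen r1 s1) `&` f2 (rgen r2 s2) `&` f3 (rgen r3 s3)) <= b) ->
  a `&` alpha (rgen p q) <= b.

Section Represents.
Variables f1 f2 f3 : contfun L.
Local Notation repr := (represents f1 f2 f3).

Lemma repr1 : repr (fun x _ _ => x) f1.
Proof.
move=> p q a b h; apply: (contfun_cover (phi := f2)) => r2 s2.
apply: (contfun_cover (phi := f3)) => r3 s3; rewrite -!meetA.
by rewrite [X in a `&` X]meetA; apply: h.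
Qed.

Lemma repr2 : repr (fun _ y _ => y) f2.
Proof.
move=> p q a b h; apply: (contfun_cover (phi := f1)) => r2 s2.
apply: (contfun_cover (phi := f3)) => r3 s3; rewrite -!meetA.
by rewrite [X in a `&` X]meetA [f2 _ `&` _]meetC; apply: h.
Qed.

Lemma repr3 : repr (fun _ _ z => z) f3.
Proof.
move=> p q a b h; apply: (contfun_cover (phi := f1)) => r2 s2.
apply: (contfun_cover (phi := f2)) => r3 s3; rewrite -!meetA.
by rewrite [X in a `&` X]meetC; apply: h.
Qed.

Lemma repr_cst c : repr (fun _ _ _ => c) (contfun_cst c).
Proof.
move=> p q a b h; rewrite rliftE /contfun_cst_fun.
case: ifP => pcq; last by rewrite meetx0 le0x.
rewrite meetx1; apply: (contfun_cover (phi := f1)) => r1 s1.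
apply: (contfun_cover (phi := f2)) => r2 s2; apply: (contfun_cover (phi := f3)) => r3 s3.
by rewrite -!meetA [X in a `&` X]meetA; apply: h.
Qed.

Lemma repr_op f (gf : good_op f) F G H phi psi :
  repr F phi -> repr G psi -> (forall x y z, H x y z = f (F x y z) (G x y z)) ->
  repr H (rlift (contfun_op_relations phi psi gf)).
Proof.
move=> rF rG HE p q a b h; rewrite rliftE; apply: contfun_op_le => r s t u bf.
rewrite meetA; apply: rG => r1 s1 r2 s2 r3 s3 bG.
rewrite meetAC; apply: rF => r1' s1' r2' s2' r3' s3' bF.
rewrite -meetA [X in a `&` X]meetACA [X in _ `&` (X `&` _)]meetACA !contfun_meet.
apply: h => x y z; rewrite !gt_max !lt_min.
move=> /andP[/andP[x1 x2] /andP[x3 x4]] /andP[/andP[y1 y2] /andP[y3 y4]].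
move=> /andP[/andP[z1 z2] /andP[z3 z4]]; rewrite HE; apply: bf.
  by apply: bF; apply/andP; split.
by apply: bG; apply/andP; split.
Qed.

Lemma repr_unique F phi psi : repr F phi -> repr F psi -> phi = psi.
Proof.
move=> rphi rpsi.
have main (f g : contfun L) p q r s : repr F f -> repr F g -> q <= r ->
    f (rgen p q) `&` g (rgen r s) <= \bot.
  move=> rf rg qr; apply: rg => r1 s1 r2 s2 r3 s3 bg; rewrite meetC.
  apply: rf => r1' s1' r2' s2' r3' s3' bf.
  rewrite meetACA [X in X `&` _]meetACA !contfun_meet.
  set A1 := Order.max r1 _; set B1 := Order.min s1 _.
  set A2 := Order.max r2 _; set B2 := Order.min s2 _.
  set A3 := Order.max r3 _; set B3 := Order.min s3 _.
  have [h|h1] := leP B1 A1; first by rewrite (contfun_empty f1 h) !meet0x.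
  have [h|h2] := leP B2 A2; first by rewrite (contfun_empty f2 h) meetx0 meet0x.
  have [h|h3] := leP B3 A3; first by rewrite (contfun_empty f3 h) meetx0.
  exfalso.
  have mid (A B : rat) : A < B -> A < (A + B) / 2 < B by move=> ?; apply/andP; split; lra.
  move: (mid _ _ h1) (mid _ _ h2) (mid _ _ h3).
  rewrite !gt_max !lt_min => /andP[/andP[x1 x2] /andP[x3 x4]].
  move=> /andP[/andP[y1 y2] /andP[y3 y4]] /andP[/andP[z1 z2] /andP[z3 z4]].
  have := bg _ _ _ ltac:(by apply/andP; split; [exact: x1|exact: x3])
     ltac:(by apply/andP; split; [exact: y1|exact: y3])
     ltac:(by apply/andP; split; [exact: z1|exact: z3]).
  have := bf _ _ _ ltac:(by apply/andP; split; [exact: x2|exact: x4])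
     ltac:(by apply/andP; split; [exact: y2|exact: y4])
     ltac:(by apply/andP; split; [exact: z2|exact: z4]).
  by move=> /andP[_ ?] /andP[? _]; lra.
by apply: contfun_eq => p q r s qr; split; apply: main.
Qed.

End Represents.

Let repr_add (f1 f2 f3 : contfun L) := @repr_op f1 f2 f3 _ good_add.
Let repr_mul (f1 f2 f3 : contfun L) := @repr_op f1 f2 f3 _ good_mul.

(* The pointwise function is an existential variable in [repr_rec]. *)
Local Ltac repr_rec :=
  match goal with
  | |- represents _ _ _ _ (contfun_add _ _) =>
      apply: repr_add; [repr_rec | repr_rec | by move=> x y z; reflexivity]
  | |- represents _ _ _ _ (contfun_mul _ _) =>
      apply: repr_mul; [repr_rec | repr_rec | by move=> x y z; reflexivity]
  | |- _ => first [exact: repr1 | exact: repr2 | exact: repr3 | exact: repr_cst]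
  end.

Local Ltac repr_tac :=
  match goal with
  | |- represents _ _ _ _ (contfun_add _ _) =>
      apply: repr_add; [repr_rec | repr_rec | by move=> x y z; cbv beta; ring]
  | |- represents _ _ _ _ (contfun_mul _ _) =>
      apply: repr_mul; [repr_rec | repr_rec | by move=> x y z; cbv beta; ring]
  | |- _ => repr_rec
  end.

Local Ltac by_repr f g h F :=
  apply: (@repr_unique f g h F); repr_tac.

Definition contfun_opp phi := contfun_mul (contfun_cst (- 1)) phi.

Fact contfun_addA : associative contfun_add.
Proof. by move=> f g h; by_repr f g h (fun x y z : rat => x + y + z)%R. Qed.

Fact contfun_addC : commutative contfun_add.
Proof. by move=> f g; by_repr f g g (fun x y z : rat => x + y)%R. Qed.

Fact contfun_add0 : left_id (contfun_cst 0) contfun_add.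
Proof. by move=> f; by_repr f f f (fun x y z : rat => x). Qed.

Fact contfun_addN : left_inverse (contfun_cst 0) contfun_opp contfun_add.
Proof. by rewrite /contfun_opp => f; by_repr f f f (fun x y z : rat => 0 : rat)%R. Qed.

Fact contfun_mulA : associative contfun_mul.
Proof. by move=> f g h; by_repr f g h (fun x y z : rat => x * y * z)%R. Qed.

Fact contfun_mulC : commutative contfun_mul.
Proof. by move=> f g; by_repr f g g (fun x y z : rat => x * y)%R. Qed.

Fact contfun_mul1 : left_id (contfun_cst 1) contfun_mul.
Proof. by move=> f; by_repr f f f (fun x y z : rat => x). Qed.

Fact contfun_mulDl : left_distributive contfun_mul contfun_add.
Proof. by move=> f g h; by_repr f g h (fun x y z : rat => (x + y) * z)%R. Qed.

HB.instance Definition _ := GRing.isZmodule.Build (contfun L)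
  contfun_addA contfun_addC contfun_add0 contfun_addN.
HB.instance Definition _ := GRing.Zmodule_isComPzRing.Build (contfun L)
  contfun_mulA contfun_mulC contfun_mul1 contfun_mulDl.

Lemma contfun_addE phi psi p q :
  (phi + psi)%R (rgen p q) = contfun_op +%R phi psi p q.
Proof. exact: rliftE. Qed.

Lemma contfun_mulE phi psi p q :
  (phi * psi)%R (rgen p q) = contfun_op *%R phi psi p q.
Proof. exact: rliftE. Qed.

End Operations.

(** * Cozero elements, d-ideals and P_F-frames *)

Section Cozero.
Context {d : Order.disp_t} {L : frameType d}.
Implicit Types a b : L.

Definition pseudocompl a : L := bigjoin [set x | x `&` a = \bot].

Definition complemented a : Prop := a `|` pseudocompl a = \top.

Definition rather_below a b : Prop := exists t, a `&` t = \bot /\ t `|` b = \top.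

(* Only the values of [c] on the rationals of [0, 1] matter. *)
Definition completely_below a b : Prop :=
  exists c : rat -> L, [/\ c 0%R = a, c 1%R = b &
    forall r s : rat, 0%R <= r -> r < s -> s <= 1%R -> rather_below (c r) (c s)].

Definition coz (phi : contfun L) : L :=
  bigjoin [set a | exists p q : rat, a = phi (rgen p 0) `|` phi (rgen 0 q)].

End Cozero.

Definition completely_regular {d} (L : frameType d) : Prop :=
  forall a : L, a = bigjoin [set x | completely_below x a].

Definition Coz {d} (L : frameType d) : set L := range (@coz d L).
Arguments Coz {d} L.

Definition P_F_frame {d} (L : frameType d) : Prop :=
  forall a b : L, Coz L a -> Coz L b -> a `&` b = \bot ->
    complemented a \/ complemented b.

(* Ideals need not be proper. *)
Definition is_ideal {R : comPzRingType} (I : set R) : Prop :=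
  [/\ I 0%R, forall x y, I x -> I y -> I (x + y)%R & forall a x, I x -> I (a * x)%R].

Definition ideal_sum {R : comPzRingType} (I J : set R) : set R :=
  [set (x + y)%R | x in I & y in J].

Definition d_ideal {d} {L : frameType d} (I : set (contfun L)) : Prop :=
  is_ideal I /\ forall alpha f : contfun L,
    I f -> coz alpha <= pseudocompl (pseudocompl (coz f)) -> I alpha.

(* Main.v *)
Require Import Defs.
From mathcomp Require Import all_boot all_order all_algebra.
From mathcomp Require Import boolp classical_sets.
From mathcomp Require Import ring lra.

(** The argument takes place in the commutative ring RL, the frame entering only
    through the map coz, which turns products into meets, satisfies
    coz (f + g) <= coz f \/ coz g, and vanishes only at 0.  Three facts about
    continuous functions are needed, and all come from a pointwise calculus: an
    identity between functions of rationals gives an identity in RL as soon as both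
    sides are built from continuous operations.

    - Every function has a cube root, hence a ninth root, with the same cozero
      element ([cube_root]).  A d-ideal is therefore closed under these roots.
    - If coz f is complemented, then coz f = coz e for an idempotent e that is a
      multiple of f ([complemented_coz_idempotent]).  Every alpha with
      coz alpha <= (coz f)** is then a multiple of f.
    - If u >= 0, then max (u, v) divides u ^ 2 ([mulr_quot]): the quotient
      u ^ 2 / max (u, v) extends by 0 to a Lipschitz function.

    In a P_F-frame, the positive parts of u ^ 2 - v ^ 2 and v ^ 2 - u ^ 2 have
    disjoint cozero elements, so one of them is complemented.  Cutting with the
    corresponding idempotent e gives the comparison lemma [P_F_compare]: up to
    exchanging u and v, u divides e and v divides (1 - e) u ^ 4.  In words: on one
    clopen piece u is invertible, on the other u is dominated by v.  So the local
    rings of RL behave like valuation rings, up to powers; the properties of ideals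
    follow.  Let I and J be ideals.

    - d-ideals I, J and coz alpha <= (coz (i + j))**, i in I, j in J: compare i and
      j.  Then e alpha lies in I as e does, and (1 - e) alpha lies in J because
      coz ((1 - e) i) <= coz j.
    - I /\ J a d-ideal, f in I, coz alpha <= (coz f)**, and a g in J: compare f and
      g.  Again e alpha lies in I, and (1 - e) alpha lies in I /\ J because
      coz ((1 - e) f) <= coz (f g).
    - I + J a d-ideal, alpha outside I and beta outside J witnessing that I and J
      are not d-ideals.  Ninth roots lie in I + J, so alpha is congruent to j ^ 9
      modulo I and beta to i ^ 9 modulo J.  Comparing j and i puts
      (1 - e) alpha in I and e beta in J, or the other way round.  The remaining
      parts e alpha and (1 - e) beta have witnesses e f and (1 - e) g with disjoint
      cozero elements; one of these is complemented, so the corresponding part is a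
      multiple of its witness and lies in the ideal.

    Conversely, let coz f /\ coz g = 0.  A d-ideal whose elements have the form
    f y + k with f k = 0 contains the cube root of f, and this forces coz f to be
    complemented ([principal_plus_d_ideal]).  For the intersection property, apply
    this to (f) and (g), which meet in 0.  For the sums, let A and B be the double
    annihilators of f and g; the ideals (f) + B and A + (g) have sum A + B.  This
    sum could be all of RL, so f is first replaced by f1 = f (q - f ^ 2)^+, which
    is annihilated by k = (f ^ 2 - q)^+.  For some rational q > 0 the function k is
    nonzero ([square_level]), and A + B is then contained in the proper ideal Ann k;
    and coz f1 is complemented only if coz f is ([truncated_square]). *)

Set Implicit Arguments.
Unset Strict Implicit.
Unset Printing Implicit Defensive.
Import Order.TTheory GRing.Theory Num.Theory.

Local Open Scope classical_set_scope.
Local Open Scope ring_scope.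
Local Open Scope order_scope.

(** * Pseudocomplements *)

Section FrameLattice.
Context {d : Order.disp_t} {L : frameType d}.
Implicit Types a b c x y : L.

Lemma frame_meetUr a b c : a `&` (b `|` c) = (a `&` b) `|` (a `&` c).
Proof. by rewrite -!bigjoin2 meet_bigjoin image_setU !image_set1. Qed.

Lemma frame_meetUl a b c : (b `|` c) `&` a = (b `&` a) `|` (c `&` a).
Proof. by rewrite ![_ `&` a]meetC frame_meetUr. Qed.

Lemma le_by_cases a b x y : a `|` b = \top -> a `&` x <= y -> b `&` x <= y -> x <= y.
Proof. by move=> ab h1 h2; rewrite -[x]meet1x -ab frame_meetUl leUx h1. Qed.

Lemma meet_pseudocompl a : a `&` pseudocompl a = \bot.
Proof.
apply/eqP; rewrite -lex0; apply: meet_bigjoin_le => x /= xa.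
by rewrite meetC xa.
Qed.

Lemma le_pseudocompl a x : (x <= pseudocompl a) = (x `&` a == \bot).
Proof.
apply/idP/eqP => [xa|xa]; last exact: bigjoin_ub.
by apply/eqP; rewrite -lex0 -(meet_pseudocompl a) meetC leI2.
Qed.

Lemma le_double_pseudocompl a : a <= pseudocompl (pseudocompl a).
Proof. by rewrite le_pseudocompl meet_pseudocompl. Qed.

Lemma pseudocompl_anti a b : a <= b -> pseudocompl b <= pseudocompl a.
Proof.
move=> ab; rewrite le_pseudocompl -lex0 -(meet_pseudocompl b) [leRHS]meetC.
by apply: leI2; rewrite ?lexx.
Qed.

Lemma double_pseudocompl_mono a b :
  a <= b -> pseudocompl (pseudocompl a) <= pseudocompl (pseudocompl b).
Proof. by move=> ab; do 2!apply: pseudocompl_anti. Qed.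

Lemma double_pseudocomplK a :
  pseudocompl (pseudocompl (pseudocompl a)) = pseudocompl a.
Proof.
by apply/le_anti; rewrite le_double_pseudocompl pseudocompl_anti// le_double_pseudocompl.
Qed.

(** Double pseudocomplementation is a nucleus; this half of its compatibility with
    meets lets the inequality defining d-ideals be multiplied by a function. *)
Lemma meet_double_pseudocompl a b :
  a `&` pseudocompl (pseudocompl b) <= pseudocompl (pseudocompl (a `&` b)).
Proof.
rewrite le_pseudocompl meetAC.
have : a `&` pseudocompl (a `&` b) <= pseudocompl b.
  by rewrite le_pseudocompl meetAC meet_pseudocompl.
move=> h; rewrite -lex0 -(meet_pseudocompl (pseudocompl b)).
by apply: leI2; rewrite ?lexx.
Qed.

Lemma double_pseudocompl_disjoint a b :
  a `&` b = \bot -> pseudocompl (pseudocompl a) `&` b = \bot.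
Proof.
move=> /eqP; rewrite meetC -le_pseudocompl => ba; apply/eqP; rewrite -lex0.
by rewrite -(meet_pseudocompl (pseudocompl a)) [leRHS]meetC leI2.
Qed.

Lemma complementedP a : complemented a <-> exists2 c, a `&` c = \bot & a `|` c = \top.
Proof.
split=> [ca|[c disj cov]]; first by exists (pseudocompl a) => //; apply: meet_pseudocompl.
apply/le_anti; rewrite lex1 /= -cov leUx leUl /=.
by apply: lexUr => //; rewrite le_pseudocompl meetC disj.
Qed.

Lemma complemented_double_pseudocompl a :
  complemented a -> pseudocompl (pseudocompl a) = a.
Proof.
move=> ca; apply/le_anti; rewrite le_double_pseudocompl andbT.
by apply: (le_by_cases ca); rewrite ?leIl// meet_pseudocompl le0x.
Qed.

Lemma complemented_bot : complemented (\bot : L).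
Proof. by apply/complementedP; exists \top; rewrite ?meet0x ?join0x. Qed.

End FrameLattice.

(** * Arithmetic of cozero elements *)

Section CozeroArithmetic.
Context {d : Order.disp_t} {L : frameType d}.
Implicit Types (phi psi : contfun L) (c : L).

(** Every interval ]r, s[ that avoids 0 counts in the definition of [coz], not only
    those with an endpoint at 0. *)
Definition off_zero (r s : rat) := (s <= 0%R) || (0%R <= r).

Lemma le_coz phi r s : off_zero r s -> phi (rgen r s) <= coz phi.
Proof.
move=> /orP[s0|r0].
  apply: (@le_trans _ _ (phi (rgen r 0) `|` phi (rgen 0 0))); last first.
    by apply: bigjoin_ub; exists r, 0%R.
  by apply: lexUl; apply: contfun_le.
apply: (@le_trans _ _ (phi (rgen 0 0) `|` phi (rgen 0 s))); last first.
  by apply: bigjoin_ub; exists 0%R, s.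
by apply: lexUr; apply: contfun_le.
Qed.

Lemma meet_coz_le phi (a b : L) :
  (forall r s, off_zero r s -> a `&` phi (rgen r s) <= b) -> a `&` coz phi <= b.
Proof.
move=> h; apply: meet_bigjoin_le => _ [p [q ->]].
by rewrite frame_meetUr leUx !h// /off_zero lexx ?orbT.
Qed.

Lemma coz_le phi c : (forall r s, off_zero r s -> phi (rgen r s) <= c) -> coz phi <= c.
Proof.
by move=> h; rewrite -[coz _]meet1x; apply: meet_coz_le => r s /h; rewrite meet1x.
Qed.

Lemma not_off_zero r s : ~~ off_zero r s -> r < 0%R < s.
Proof. by rewrite negb_or -!ltNge andbC. Qed.

Lemma contfun_cstE (k p q : rat) :
  contfun_cst k (rgen p q) = if p < k < q then \top else (\bot : L).
Proof. exact: rliftE. Qed.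

Lemma coz_cst (q : rat) : q != 0%R -> coz (contfun_cst q) = \top :> L.
Proof.
move=> q0; apply/le_anti; rewrite lex1 /=.
have [q_lt0|q_gt0|/eqP] := ltgtP q 0%R; last by rewrite (negPf q0).
  apply: le_trans (le_coz _ (r := q - 1) (s := 0) _); last by rewrite /off_zero lexx.
  by rewrite contfun_cstE q_lt0 andbT ifT//; lra.
apply: le_trans (le_coz _ (r := 0) (s := q + 1) _); last by rewrite /off_zero lexx orbT.
by rewrite contfun_cstE q_gt0 ifT//; lra.
Qed.

Lemma coz1 : coz (1%R : contfun L) = \top.
Proof. exact: coz_cst. Qed.

Lemma coz_eq0 phi : coz phi = \bot -> phi = 0%R.
Proof.
move=> phi0; have phiE r s : off_zero r s -> phi (rgen r s) = \bot.
  by move=> /(le_coz phi); rewrite phi0 lex0 => /eqP.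
have zeroE r s : (0%R : contfun L) (rgen r s) = if r < 0%R < s then \top else \bot.
  exact: contfun_cstE.
apply: contfun_eq => p q r s qr; split.
  have [pq|/not_off_zero/andP[p0 q0]] := boolP (off_zero p q).
    by rewrite phiE// meet0x lexx.
  rewrite zeroE ifN ?meetx0 ?lexx//; apply/negP => /andP[r0 _].
  by have := lt_trans (lt_le_trans q0 qr) r0; rewrite ltxx.
have [rs|/not_off_zero/andP[r0 s0]] := boolP (off_zero r s).
  by rewrite phiE// meetx0 lexx.
rewrite zeroE ifN ?meet0x ?lexx//; apply/negP => /andP[_ q0].
by have := lt_trans (lt_le_trans q0 qr) r0; rewrite ltxx.
Qed.

Lemma coz0 : coz (0%R : contfun L) = \bot.
Proof.
apply/eqP; rewrite -lex0; apply: coz_le => r s rs.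
have -> : (0%R : contfun L) (rgen r s) = if r < 0%R < s then \top else \bot.
  exact: contfun_cstE.
rewrite ifN //; apply/negP => /andP[r0 s0].
by move: rs; rewrite /off_zero !leNgt r0 s0.
Qed.

Lemma cozD phi psi : coz (phi + psi)%R <= coz phi `|` coz psi.
Proof.
apply: coz_le => p q pq; rewrite contfun_addE -[leLHS]meet1x.
apply: contfun_op_le => r s t u bf; rewrite meet1x.
have [rs|/not_off_zero rs] := boolP (off_zero r s).
  by apply: leIxl; apply: lexUl; apply: le_coz.
have [tu|/not_off_zero tu] := boolP (off_zero t u).
  by apply: leIxr; apply: lexUr; apply: le_coz.
have := bf _ _ rs tu; rewrite addr0 => /andP[p0 q0].
by move: pq; rewrite /off_zero leNgt q0 leNgt p0.
Qed.

(** If all products of points of a nonempty box avoid 0, then both sides of the box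
    do.  Conversely, a product of two intervals avoiding 0 avoids 0, but is
    bounded only after the intervals are shrunk. *)
Lemma cozM phi psi : coz (phi * psi)%R = coz phi `&` coz psi.
Proof.
apply/le_anti/andP; split.
  apply: coz_le => p q pq; rewrite contfun_mulE -[leLHS]meet1x.
  apply: contfun_op_le => r s t u bf; rewrite meet1x.
  have [sr|rs] := leP s r; first by rewrite contfun_empty// meet0x le0x.
  have [ut|tu] := leP u t; first by rewrite (contfun_empty psi)// meetx0 le0x.
  have mid (x y : rat) : x < y -> x < (x + y) / 2 < y by move=> ?; apply/andP; split; lra.
  have no0 : ~~ (p < 0%R < q).
    by apply/negP => /andP[p0 q0]; move: pq; rewrite /off_zero !leNgt p0 q0.
  apply: leI2; apply: le_coz; apply/negPn/negP => /not_off_zero h.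
    by have := bf _ _ h (mid _ _ tu); rewrite mul0r (negPf no0).
  by have := bf _ _ (mid _ _ rs) h; rewrite mulr0 (negPf no0).
apply: meet_coz_le => t u tu; rewrite meetC; apply: meet_coz_le => r s rs; rewrite meetC.
apply: contfun_inner => t' u' tt' tu' uu'; rewrite meetC.
apply: contfun_inner => r' s' rr' rs' ss'; rewrite meetC.
have [p [q bf]] := op_bounded good_mul r' s' t' u'.
(* The product of the intervals lies on one side of 0: cut its bounds there. *)
pose sg := ((s <= 0%R) == (u <= 0%R)).
have : box_sub *%R r' s' t' u' (if sg then Num.max p 0%R else p) (if sg then q else Num.min q 0%R).
  move=> x y xx yy; have /andP[px qx] := bf x y xx yy.
  move: xx yy rs tu => /andP[? ?] /andP[? ?]; rewrite /sg /off_zero.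
  have [s0|s0] := leP s 0%R; have [u0|u0] := leP u 0%R => /= *;
    rewrite ?gt_max ?lt_min px qx /= ?andbT; clear bf px qx; nra.
move/(contfun_op_ub phi psi)/le_trans; apply; rewrite -contfun_mulE; apply: le_coz.
by rewrite /off_zero /sg; case: (_ == _); rewrite ?le_max ?ge_min ?lexx ?orbT.
Qed.

Lemma cozX phi n : (0 < n)%N -> coz (phi ^+ n)%R = coz phi.
Proof.
case: n => // n _; elim: n => [|n IH]; first by rewrite expr1.
by rewrite exprS cozM IH meetxx.
Qed.

Lemma coz_mul_le phi psi : coz (phi * psi)%R <= coz phi.
Proof. by rewrite cozM leIl. Qed.

Lemma mul_eq0_coz phi psi : coz phi `&` coz psi = \bot <-> (phi * psi = 0)%R.
Proof. by rewrite -cozM; split=> [/coz_eq0//|->]; rewrite coz0. Qed.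

End CozeroArithmetic.

(** * Maximum and quotient of continuous functions *)

Section NewOperations.

(** For [0 < x <= y] this is [x ^+ 2 / y], which, unlike [x / y], extends by 0 to a
    Lipschitz function; beyond [x = y] it goes on as [x], which keeps it monotone in
    each variable. *)
Definition quot (x y : rat) : rat := if x <= 0%R then 0%R else (x ^+ 2 / Num.max x y)%R.

Lemma good_max : good_op Num.max.
Proof.
split.
- move=> r s t u; exists (Num.min r t), (Num.max s u) => x y /andP[? ?] /andP[? ?].
  by case: (leP x y); case: (leP r t); case: (leP s u) => *; apply/andP; split; lra.
- move=> r s t u e e0; exists e => // x x' y y' _ _ _ _.
  rewrite !ltr_norml => /andP[? ?] /andP[? ?].
  by case: (leP x y); case: (leP x' y') => *; lra.
- move=> a b x y m /andP[? ?].
  by case: (leP a y); case: (leP b y); case: (leP x y) => *; split; lra.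
- move=> a b x y m /andP[? ?].
  by case: (leP y a); case: (leP y b); case: (leP y x) => *; split; lra.
Qed.

Lemma quot_bounds x y : (0 <= quot x y <= Num.max x 0)%R.
Proof.
rewrite /quot; have [x0|x0] := leP x 0%R; first by rewrite lexx.
have m0 : (0 < Num.max x y)%R by rewrite lt_max x0.
apply/andP; split; first by apply: divr_ge0; [apply: sqr_ge0|apply: ltW].
rewrite ler_pdivrMr// expr2; apply: ler_wpM2l; first exact: ltW.
by rewrite le_max lexx.
Qed.

(** The source of all divisibility relations below. *)
Lemma mulr_quot x y : (Num.max (Num.max x 0) y * quot x y = Num.max x 0 ^+ 2)%R.
Proof.
rewrite /quot; have [x0|x0] := leP x 0%R; first by rewrite mulr0 expr0n.
by rewrite mulrC divfK// gt_eqF// lt_max x0.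
Qed.

Lemma quot_lip_l x x' y : (x <= x' -> quot x y <= quot x' y <= quot x y + 2 * (x' - x))%R.
Proof.
move=> xx; have [x0|x0] := leP x 0%R.
  have := quot_bounds x' y; have -> : quot x y = 0%R by rewrite /quot x0.
  by have [x'0|x'0] := leP x' 0%R => /andP[? ?]; apply/andP; split; lra.
have x'0 : (0 < x')%R by lra.
rewrite /quot [x <= _]leNgt [x' <= _]leNgt x0 x'0 /=.
have m0 : (0 < Num.max x y)%R by rewrite lt_max x0.
have m'0 : (0 < Num.max x' y)%R by rewrite lt_max x'0.
have e1 : (x ^+ 2 / Num.max x y * Num.max x y = x ^+ 2)%R by rewrite divfK// gt_eqF.
have e2 : (x' ^+ 2 / Num.max x' y * Num.max x' y = x' ^+ 2)%R by rewrite divfK// gt_eqF.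
have y_mono (u v : rat) : (0 < y -> u * y <= v * y -> u <= v)%R by move=> y0; rewrite ler_pM2r.
move: e1 e2; set A := (_ / _)%R; set B := (_ / _)%R.
case: (leP x y) m0; case: (leP x' y) m'0 => h' m'0 h m0 e1 e2; last 2 first.
- by exfalso; lra.
- have -> : A = x by apply: (mulIf (lt0r_neq0 m0)); rewrite e1 expr2.
  have -> : B = x' by apply: (mulIf (lt0r_neq0 m'0)); rewrite e2 expr2.
  by apply/andP; split; lra.
- by apply/andP; split; apply: y_mono => //; nra.
- have -> : B = x' by apply: (mulIf (lt0r_neq0 m'0)); rewrite e2 expr2.
  by apply/andP; split; apply: y_mono => //; nra.
Qed.

Lemma quot_lip_r x y y' : (y <= y' -> quot x y' <= quot x y <= quot x y' + (y' - y))%R.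
Proof.
move=> yy; rewrite /quot; have [x0|x0] := leP x 0%R; first by apply/andP; split; lra.
have m0 : (0 < Num.max x y)%R by rewrite lt_max x0.
have m'0 : (0 < Num.max x y')%R by rewrite lt_max x0.
have e1 : (x ^+ 2 / Num.max x y * Num.max x y = x ^+ 2)%R by rewrite divfK// gt_eqF.
have e2 : (x ^+ 2 / Num.max x y' * Num.max x y' = x ^+ 2)%R by rewrite divfK// gt_eqF.
have mono (z u v : rat) : (0 < z -> u * z <= v * z -> u <= v)%R by move=> z0; rewrite ler_pM2r.
move: e1 e2; set A := (_ / _)%R; set B := (_ / _)%R.
case: (leP x y) m0; case: (leP x y') m'0 => h' m'0 h m0 e1 e2.
- have Ay : (A <= y)%R by apply: (mono y) => //; nra.
  have BA : (B <= A)%R by apply: (mono y') => //; nra.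
  by rewrite BA; apply: (mono y') => //; nra.
- by exfalso; lra.
- have -> : A = x by apply: (mulIf (lt0r_neq0 m0)); rewrite e1 expr2.
  by apply/andP; split; apply: (mono y') => //; nra.
- have -> : A = x by apply: (mulIf (lt0r_neq0 m0)); rewrite e1 expr2.
  have -> : B = x by apply: (mulIf (lt0r_neq0 m'0)); rewrite e2 expr2.
  by apply/andP; split; lra.
Qed.

(** The two Lipschitz estimates contain the monotonicity in each variable, which
    gives the betweenness conditions. *)
Lemma good_quot : good_op quot.
Proof.
split.
- move=> r s t u; exists (- 1)%R, (`|s| + 1)%R => x y /andP[_ xs] _.
  have /andP[q0 qx] := quot_bounds x y; have := ler_norm s; have := normr_ge0 s.
  by move: qx; case: (leP x 0%R) => *; apply/andP; split; lra.
- move=> r s t u e e0; exists (e / 4)%R; first by lra.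
  move=> x x' y y' _ _ _ _; rewrite !ltr_norml => /andP[? ?] /andP[? ?].
  have h1 : (quot x y <= quot x' y + 2 * (e / 4))%R.
    by have [/(quot_lip_l y)|/ltW/(quot_lip_l y)] := leP x x' => /andP[? ?]; lra.
  have h2 : (quot x' y <= quot x' y' + e / 4)%R.
    by have [/(quot_lip_r x')|/ltW/(quot_lip_r x')] := leP y y' => /andP[? ?]; lra.
  by lra.
- move=> a b x y m /andP[/ltW/(quot_lip_l y)/andP[? _] /ltW/(quot_lip_l y)/andP[? _]].
  by split; lra.
- move=> a b x y m /andP[/ltW/(quot_lip_r y)/andP[? _] /ltW/(quot_lip_r y)/andP[? _]].
  by split; lra.
Qed.

Section Calculus.
Context {d : Order.disp_t} {L : frameType d}.
Implicit Types phi psi f g h : contfun L.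

Definition contfun_max phi psi : contfun L := rlift (contfun_op_relations phi psi good_max).
Definition contfun_quot phi psi : contfun L := rlift (contfun_op_relations phi psi good_quot).

(** [represents] determines its function, so identities in the ring of continuous
    functions reduce to identities between functions of rationals. *)
Lemma represents_eq f g h F G phi psi :
  represents f g h F phi -> represents f g h G psi ->
  (forall x y z, F x y z = G x y z) -> phi = psi.
Proof.
move=> rF rG FG; apply: repr_unique rF _.
by congr (represents f g h _ psi): rG; do 3!apply/funext => ?.
Qed.

Lemma represents_add f g h F G phi psi :
  represents f g h F phi -> represents f g h G psi ->
  represents f g h (fun x y z => F x y z + G x y z)%R (phi + psi)%R.
Proof. by move=> rF rG; apply: (repr_op good_add rF rG). Qed.

Lemma represents_mul f g h F G phi psi :
  represents f g h F phi -> represents f g h G psi ->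
  represents f g h (fun x y z => F x y z * G x y z)%R (phi * psi)%R.
Proof. by move=> rF rG; apply: (repr_op good_mul rF rG). Qed.

Lemma represents_exp f g h F phi n : represents f g h F phi ->
  represents f g h (fun x y z => F x y z ^+ n)%R (phi ^+ n)%R.
Proof.
move=> rF; elim: n => [|n IH]; first exact: repr_cst.
rewrite exprS; have -> : (fun x y z => F x y z ^+ n.+1)%R = (fun x y z => F x y z * F x y z ^+ n)%R.
  by do 3!apply/funext => ?; rewrite exprS.
exact: represents_mul.
Qed.

Lemma represents_opp f g h F phi :
  represents f g h F phi -> represents f g h (fun x y z => - F x y z)%R (- phi)%R.
Proof.
move=> rF; change (represents f g h (fun x y z => - F x y z)%R (contfun_opp phi)).
exact: (repr_op good_mul (@repr_cst _ _ f g h (- 1)%R) rF (fun _ _ _ => esym (mulN1r _))).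
Qed.

Lemma represents_max f g h F G phi psi :
  represents f g h F phi -> represents f g h G psi ->
  represents f g h (fun x y z => Num.max (F x y z) (G x y z)) (contfun_max phi psi).
Proof. by move=> rF rG; apply: (repr_op good_max rF rG). Qed.

Lemma represents_quot f g h F G phi psi :
  represents f g h F phi -> represents f g h G psi ->
  represents f g h (fun x y z => quot (F x y z) (G x y z)) (contfun_quot phi psi).
Proof. by move=> rF rG; apply: (repr_op good_quot rF rG). Qed.

End Calculus.
End NewOperations.

(* Computes a pointwise function for an expression in [f], [g], [h]; hypotheses take
   precedence, so that a function defined by substitution can be used as well. *)
Ltac represent :=
  match goal with
  | |- represents _ _ _ _ (_ + _)%R => apply: represents_add; represent
  | |- represents _ _ _ _ (_ * _)%R => apply: represents_mul; represent
  | |- represents _ _ _ _ (_ ^+ _)%R => apply: represents_exp; represent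
  | |- represents _ _ _ _ (- _)%R => apply: represents_opp; represent
  | |- represents _ _ _ _ (contfun_max _ _) => apply: represents_max; represent
  | |- represents _ _ _ _ (contfun_quot _ _) => apply: represents_quot; represent
  | |- represents _ _ _ _ (GRing.zero) => apply: repr_cst
  | |- represents _ _ _ _ (GRing.one) => apply: repr_cst
  | |- _ => first [eassumption | exact: repr1 | exact: repr2 | exact: repr3 | exact: repr_cst]
  end.

(* Reduces an equation between expressions in [f], [g], [h] to its pointwise form. *)
Ltac pointwise f g h :=
  apply: (@represents_eq _ _ f g h); [represent | represent | move=> x y z; cbv beta].

(** * Substitution, cube roots and squares *)

Section Substitution.
Context {d : Order.disp_t} {L : frameType d}.
Implicit Types alpha u t : contfun L.

(** Solves [rho t = alpha] by [t (p, q) = alpha (rho p, rho q)].  As [rho] acts on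
    rationals only, its inverse need not map rationals to rationals; density of the
    range is what makes the formula a solution. *)
Lemma contfun_substitution (rho : rat -> rat) alpha :
  (forall x y, x < y -> rho x < rho y) ->
  (forall P Q x y, x < y -> rho P < y -> x < rho Q -> exists2 r, x < rho r & rho r < y) ->
  \top <= bigjoin [set a | exists P Q, a = alpha (rgen (rho P) (rho Q))] ->
  exists t, represents t t t (fun x _ _ => rho x) alpha.
Proof.
move=> incr dense cover.
have mono : {mono rho : x y / x <= y} by apply/le_mono => x y; apply: incr.
have mono_lt : {mono rho : x y / x < y} by apply: leW_mono.
have between P Q x y : rho P <= x -> x < y -> y <= rho Q ->
    exists2 r, x < rho r & rho r < y.
  by move=> Px xy yQ; apply: (dense P Q) => //; [apply: le_lt_trans xy|apply: lt_le_trans yQ].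
have rel : real_relations (fun p q => alpha (rgen (rho p) (rho q))).
  split.
  - move=> p q r s; rewrite contfun_meet; congr (alpha (rgen _ _)).
      by case: (leP p r) => pr; [apply: max_r|apply: max_l]; rewrite mono// ltW.
    by case: (leP q s) => qs; [apply: min_l|apply: min_r]; rewrite mono// ltW.
  - by move=> p q r s pr rq qs; rewrite -frameHom_join rgen_join ?mono ?mono_lt.
  - move=> p q; apply/le_anti/andP; split; last first.
      by apply: bigjoin_le => _ [r [s [pr rs sq ->]]]; apply: contfun_le; rewrite mono ltW.
    rewrite -[leLHS]meet1x; apply: contfun_inner => x y px xy yq; rewrite meet1x.
    have [|r pr rx] := between p q (rho p) x (lexx _) px; first exact: ltW (lt_trans xy yq).
    have [|s ys sq] := between p q y (rho q) _ yq (lexx _); first exact: ltW (lt_trans px xy).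
    apply: (@le_trans _ _ (alpha (rgen (rho r) (rho s)))); first by apply: contfun_le; apply: ltW.
    apply: bigjoin_ub; exists r, s; split=> //; rewrite -mono_lt//.
    exact: lt_trans rx (lt_trans xy ys).
  - by apply/le_anti; rewrite lex1 cover.
exists (rlift rel) => p q a b h.
apply: (contfun_cover (phi := rlift rel)) => P Q; rewrite rliftE -meetA contfun_meet.
apply: contfun_inner => x y; rewrite gt_max lt_min => /andP[px Px] xy /andP[yq yQ].
have PQ := lt_trans Px (lt_trans xy yQ).
have [|||r] := between P Q (Num.max p (rho P)) x.
- by rewrite le_max lexx orbT.
- by rewrite gt_max px.
- exact: ltW (lt_trans xy yQ).
rewrite gt_max => /andP[pr Pr] rx.
have [|||s ys] := between P Q y (Num.min q (rho Q)).
- exact: ltW (lt_trans Px xy).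
- by rewrite lt_min yq.
- by rewrite ge_min lexx orbT.
rewrite lt_min => /andP[sq sQ].
apply: le_trans (h r s r s r s _); last first.
  by move=> z _ _ /andP[rz zs] _ _; rewrite (lt_trans pr) ?(lt_trans _ sq) ?mono_lt.
by rewrite !meetxx rliftE leI2// contfun_le// ltW.
Qed.

(** Walk from [- B], where the cube is at most [x], in steps [e] so small that from a
    point between [- B] and [B] the cube grows by less than [y - x]; the first cube
    beyond [x] is below [y]. *)
Lemma rat_cube_dense (x y : rat) : x < y -> exists r : rat, (x < r ^+ 3 < y)%R.
Proof.
move=> xy; pose B := (1 + `|x| + `|y|)%R.
have [x1 x2 y1 y2] : [/\ x <= `|x|, - x <= `|x|, y <= `|y| & - y <= `|y|]%R.
  by split; rewrite ?ler_norm// -normrN ler_norm.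
have [nx ny] : (0 <= `|x| /\ 0 <= `|y|)%R by rewrite !normr_ge0.
have B1 : (1 <= B)%R by rewrite /B; lra.
have BB : (B <= B ^+ 3)%R by rewrite ler_eXnr.
have den : (0 < 8 * B ^+ 2)%R by nra.
pose e := ((y - x) / (8 * B ^+ 2))%R.
have eE : (e * (8 * B ^+ 2) = y - x)%R by rewrite divfK// gt_eqF.
have e0 : (0 < e)%R by rewrite divr_gt0 ?subr_gt0.
have e1 : (e <= 1)%R.
  rewrite ler_pdivrMr// mul1r; apply: (@le_trans _ _ (2 * B)%R); first by rewrite /B; lra.
  by nra.
pose r n := (- B + e * n%:R)%R.
have ex : exists n, (x < r n ^+ 3)%R.
  exists (Num.bound (2 * B / e))%R.
  have : (2 * B / e < (Num.bound (2 * B / e))%:R)%R.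
    by apply: archi_boundP; apply: divr_ge0; [apply: mulr_ge0 => //; lra|apply: ltW].
  rewrite ltr_pdivrMr// => h.
  have rB : (B <= r (Num.bound (2 * B / e)))%R by rewrite /r; lra.
  apply: (@lt_le_trans _ _ (B ^+ 3)%R); first by rewrite /B in BB *; lra.
  by rewrite lerXn2r// nnegrE; lra.
case: (ex_minnP ex) => -[|n] xr minr.
  exfalso; move: xr; rewrite /r mulr0 addr0 -mulN1r exprMn.
  have -> : ((-1) ^+ 3 = -1 :> rat)%R by [].
  by rewrite /B in BB *; lra.
exists (r n.+1); rewrite xr /=.
have rn : (r n ^+ 3 <= x)%R by rewrite leNgt; apply/negP => /minr; rewrite ltnn.
have rS : r n.+1 = (r n + e)%R by rewrite /r -natr1; ring.
have rge : (- B <= r n)%R by rewrite /r lerDl mulr_ge0// ltW.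
have rle : (r n <= B)%R.
  rewrite leNgt; apply/negP => Br.
  have : (B ^+ 3 <= r n ^+ 3)%R by rewrite lerXn2r// ?nnegrE; lra.
  by rewrite /B in BB *; lra.
rewrite rS; have -> : ((r n + e) ^+ 3 = r n ^+ 3 + e * (3 * r n ^+ 2 + 3 * r n * e + e ^+ 2))%R.
  by ring.
have : (3 * r n ^+ 2 + 3 * r n * e + e ^+ 2 < 8 * B ^+ 2)%R by nra.
by rewrite -(ltr_pM2l e0) eE; lra.
Qed.

End Substitution.

Section Roots.
Context {d : Order.disp_t} {L : frameType d}.
Implicit Types alpha : contfun L.

Lemma rat_cube_lt (x y : rat) : x < y -> (x ^+ 3 < y ^+ 3)%R.
Proof.
move=> xy; rewrite -subr_gt0.
have -> : (y ^+ 3 - x ^+ 3 = (y - x) ^+ 3 / 4 + (y - x) * (3 * (x + y) ^+ 2 / 4))%R by field.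
rewrite ltr_wpDr//; last by rewrite divr_gt0// exprn_gt0// subr_gt0.
apply: mulr_ge0; first by rewrite subr_ge0 ltW.
by apply: divr_ge0 => //; apply: mulr_ge0 => //; apply: sqr_ge0.
Qed.

Lemma cube_root alpha : exists t, (t ^+ 3)%R = alpha.
Proof.
have [x y|P Q x y xy _ _||t rt] := @contfun_substitution _ _ (fun x => x ^+ 3)%R alpha.
- exact: rat_cube_lt.
- by have [r /andP[]] := rat_cube_dense xy; exists r.
- apply: (contfun_cover (phi := alpha)) => p q; rewrite meet1x.
  have big (x : rat) : (`|x| + 1 <= (`|x| + 1) ^+ 3)%R by rewrite ler_eXnr// lerDr.
  have below : ((- (`|p| + 1)) ^+ 3 <= p)%R.
    rewrite -mulN1r exprMn (_ : (-1) ^+ 3 = -1 :> rat)%R// mulN1r.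
    by have := big p; have := ler_norm (- p); rewrite normrN; lra.
  have above : (q <= (`|q| + 1) ^+ 3)%R by have := big q; have := ler_norm q; lra.
  apply: le_trans (contfun_le alpha below above) _.
  by apply: bigjoin_ub; exists (- (`|p| + 1))%R, (`|q| + 1)%R.
by exists t; pointwise t t t.
Qed.

(** A box on which all products are negative cannot meet the diagonal. *)
Lemma square_ge0 alpha r s : (s <= 0)%R -> (alpha ^+ 2)%R (rgen r s) = \bot.
Proof.
move=> s0; apply/eqP; rewrite -lex0 expr2 contfun_mulE -[leLHS]meet1x.
apply: contfun_op_le => r1 s1 r2 s2 bf; rewrite meet1x contfun_meet.
have [h|] := leP (Num.min s1 s2) (Num.max r1 r2); first by rewrite contfun_empty.
rewrite gt_max !lt_min => /andP[/andP[h1 h2] /andP[h3 h4]].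
pose m := ((Num.max r1 r2 + Num.min s1 s2) / 2)%R.
have [mr1 mr2 ms1 ms2] : [/\ r1 < m, r2 < m, m < s1 & m < s2].
  by rewrite /m; case: (leP r1 r2); case: (leP s1 s2) => *; split; lra.
have := bf m m; rewrite mr1 mr2 ms1 ms2 => /(_ isT isT)/andP[_ m2].
by have := lt_le_trans m2 s0; rewrite -expr2 ltNge sqr_ge0.
Qed.

End Roots.

(** * Units and idempotents *)

Section Inverse.

(** An order isomorphism from the rationals onto the positive rationals, namely
    [y + 1] for [y >= 0] and [1 / (1 - y)] for [y <= 0], written with operations that
    act on continuous functions.  It turns inversion into [y |-> - y]. *)
Definition pos_chart (y : rat) : rat := (Num.max y 0 + quot 1 (1 + Num.max (- y) 0))%R.

Lemma pos_chartE y : pos_chart y = (if 0 <= y then y + 1 else (1 - y)^-1)%R.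
Proof.
rewrite /pos_chart /quot (_ : (1 : rat) <= 0%R = false)//.
have [y0|y0] := leP 0%R y.
  by rewrite (max_r (_ : - y <= 0)%R) ?oppr_le0// addr0 maxxx.
rewrite (max_l (_ : 0 <= - y)%R) ?oppr_ge0 ?ltW//.
by rewrite (max_r (_ : 1 <= 1 - y)%R) ?expr1n ?add0r ?mul1r//; lra.
Qed.

Lemma pos_chart_gt0 y : (0 < pos_chart y)%R.
Proof.
rewrite pos_chartE; have [y0|y0] := leP 0%R y; first by lra.
by rewrite invr_gt0; lra.
Qed.

Lemma pos_chartN y : (pos_chart y * pos_chart (- y) = 1)%R.
Proof.
rewrite !pos_chartE oppr_ge0 opprK.
have [y0|y0|y0] := ltgtP 0%R y.
- by rewrite addrC mulfV//; lra.
- by rewrite addrC mulVf//; lra.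
- by rewrite -y0 oppr0 !add0r mulr1.
Qed.

Lemma pos_chart_surj z : (0 < z)%R -> exists y, pos_chart y = z.
Proof.
move=> z0; have [z1|z1] := leP 1%R z.
  by exists (z - 1)%R; rewrite pos_chartE subr_ge0 z1 subrK.
exists (1 - z^-1)%R; rewrite pos_chartE subr_ge0 invf_le1// leNgt z1 /=.
by rewrite opprB addrC subrK invrK.
Qed.

Lemma pos_chart_lt x y : x < y -> (pos_chart x < pos_chart y)%R.
Proof.
move=> xy; rewrite !pos_chartE; have [x0|x0] := leP 0%R x.
  by rewrite (le_trans x0 (ltW xy)) ltrD2r.
have [y0|y0] := leP 0%R y.
  apply: (@lt_le_trans _ _ 1%R); last by lra.
  by rewrite invf_lt1; lra.
by rewrite ltf_pV2 ?posrE; lra.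
Qed.

Context {d : Order.disp_t} {L : frameType d}.
Implicit Types u w : contfun L.

(** The square of [u] is positive everywhere, so it equals [pos_chart t] for some [t],
    and [pos_chart (- t)] is its inverse. *)
Lemma coz1_unit u : coz u = \top -> exists w, (u * w = 1)%R.
Proof.
move=> cu; suff [w uw] : exists w, (u ^+ 2 * w = 1)%R.
  by exists (u * w)%R; rewrite mulrA -expr2.
have [|P Q x y xy Py xQ||t rt] := @contfun_substitution _ L pos_chart (u ^+ 2)%R.
- exact: pos_chart_lt.
- have y0 := lt_trans (pos_chart_gt0 P) Py.
  have [m0 xm my] : [/\ 0 <= Num.max x 0, x <= Num.max x 0 & Num.max x 0 < y]%R.
    by rewrite !le_max !lexx orbT gt_max xy y0.
  have [|r rE] := @pos_chart_surj ((Num.max x 0 + y) / 2)%R; first by lra.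
  by exists r; rewrite rE; lra.
- have <- : coz (u ^+ 2)%R = \top by rewrite cozX.
  apply: coz_le => r s /orP[s0|r0]; first by rewrite square_ge0 ?le0x.
  rewrite -[leLHS]meet1x; apply: contfun_inner => p q rp pq qs; rewrite meet1x.
  have p0 := le_lt_trans r0 rp.
  have [P PE] := pos_chart_surj p0.
  have [Q QE] := pos_chart_surj (lt_trans p0 pq).
  by rewrite -PE -QE; apply: bigjoin_ub; exists P, Q.
exists (contfun_max (- t) 0 + contfun_quot 1 (1 + contfun_max (- - t) 0))%R.
pointwise t t t; exact: pos_chartN.
Qed.

End Inverse.

Section Idempotents.
Context {d : Order.disp_t} {L : frameType d}.
Implicit Types (c : L) (e f g alpha : contfun L).

(** The function that agrees with [phi] on [c] and with [psi] on [c']; it exists as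
    the frame is the product of the two open parts. *)
Fact glue_hom c c' (phi psi : contfun L) : c `&` c' = \bot -> c `|` c' = \top ->
  exists e : contfun L, forall x, e x = (c `&` phi x) `|` (c' `&` psi x).
Proof.
move=> disj cov; pose e x := (c `&` phi x) `|` (c' `&` psi x).
have onl x : c `&` e x = c `&` phi x.
  by rewrite frame_meetUr !meetA meetxx disj meet0x joinx0.
have onr x : c' `&` e x = c' `&` psi x.
  by rewrite frame_meetUr !meetA meetxx [c' `&` c]meetC disj meet0x join0x.
have eq_by a b : c `&` a = c `&` b -> c' `&` a = c' `&` b -> a = b.
  by move=> h1 h2; rewrite -[a]meet1x -[b]meet1x -cov !frame_meetUl h1 h2.
have e_top : e \top = \top by rewrite /e !frameHom_top !meetx1.
have e_meet x y : e (x `&` y) = e x `&` e y.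
  apply: eq_by.
    by rewrite onl frameHom_meet -[c]meetxx meetACA -!onl meetACA meetxx.
  by rewrite onr frameHom_meet -[c']meetxx meetACA -!onr meetACA meetxx.
have e_bigjoin (S : set frame_of_reals) : e (bigjoin S) = bigjoin (e @` S).
  apply: eq_by; rewrite ?onl ?onr frameHom_bigjoin !meet_bigjoin; congr bigjoin;
  by rewrite !image_comp; apply: eq_imagel => x _ /=; rewrite ?onl ?onr.
by exists (FrameHom e_top e_meet e_bigjoin).
Qed.

Lemma complementary_idempotents c c' : c `&` c' = \bot -> c `|` c' = \top ->
  exists e e' : contfun L, [/\ (e + e' = 1)%R, coz e = c & coz e' = c'].
Proof.
move=> disj cov.
have [e eE] := glue_hom 1%R 0%R disj cov.
have [e' e'E] := glue_hom 0%R 1%R disj cov.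
have oneE p q : (1%R : contfun L) (rgen p q) = if p < 1%R < q then \top else \bot.
  exact: contfun_cstE.
have zeroE p q : (0%R : contfun L) (rgen p q) = if p < 0%R < q then \top else \bot.
  exact: contfun_cstE.
have coz_glue (a b : L) (f : contfun L) :
    (forall x, f x = (a `&` (1%R : contfun L) x) `|` (b `&` (0%R : contfun L) x)) -> coz f = a.
  move=> fE; apply/le_anti/andP; split.
    apply: coz_le => r s /orP rs; rewrite fE zeroE ifN; last first.
      by apply/negP => /andP[r0 s0]; case: rs; rewrite leNgt ?r0 ?s0.
    by rewrite meetx0 joinx0 leIl.
  apply: (@le_trans _ _ (f (rgen 0 2))); last by apply: le_coz; rewrite /off_zero lexx orbT.
  by rewrite fE oneE /= meetx1 leUl.
exists e, e'; split; last 2 first.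
- exact: coz_glue eE.
- by apply: (coz_glue c' c) => x; rewrite e'E joinC.
(* [e] and [e'] take the values 1 and 0 on [c], and 0 and 1 on [c'], so that their sum
   takes no value in an interval avoiding 1. *)
have no1 p q : ~~ (p < 1%R < q) -> (e + e')%R (rgen p q) = \bot.
  move=> no1; apply/eqP; rewrite -lex0 contfun_addE -[leLHS]meet1x.
  apply: contfun_op_le => r s t u bf; rewrite meet1x eE e'E !oneE !zeroE.
  have no_sum x y : r < x < s -> t < y < u -> (x + y = 1)%R -> False.
    by move=> xx yy xy; move: (bf x y xx yy); rewrite xy (negPf no1).
  have [r1|_] := boolP (r < 1%R < s); have [r0|_] := boolP (r < 0%R < s);
  have [t1|_] := boolP (t < 1%R < u); have [t0|_] := boolP (t < 0%R < u);
  rewrite ?meetx0 ?meetx1 ?joinx0 ?join0x ?meet0x ?meetx0 ?lexx// ?disj ?[c' `&` c]meetC ?disj ?lexx//;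
  by exfalso; first [apply: (no_sum _ _ r1 t0); rewrite addr0|
                     apply: (no_sum _ _ r0 t1); rewrite add0r].
have no_both (p q r s : rat) : q <= r -> ~~ (p < 1 < q)%R || ~~ (r < 1 < s)%R.
  move=> qr; rewrite -negb_and; apply/negP => /andP[/andP[_ h1] /andP[h2 _]].
  by have := lt_trans h1 (le_lt_trans qr h2); rewrite ltxx.
apply: contfun_eq => p q r s /(no_both p q r s).
by rewrite !oneE => /orP[] h; rewrite (negPf h) (no1 _ _ h) !(meet0x, meetx0) lexx.
Qed.

(** With [e'] the idempotent of the complement, [f + e'] has cozero element top, so it
    is a unit; on the part where [e = 1] its inverse is an inverse of [f]. *)
Lemma complemented_coz_idempotent f : complemented (coz f) ->
  exists e h : contfun L, [/\ e = (f * h)%R, (f * e = f)%R & (e * e = e)%R].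
Proof.
move=> /complementedP[c disj cov].
have [e [e' [ee' ce ce']]] := complementary_idempotents disj cov.
have fe' : (f * e' = 0)%R by apply/mul_eq0_coz; rewrite ce'.
have e_e' : (e * e' = 0)%R by apply/mul_eq0_coz; rewrite ce ce'.
have fe : (f * e = f)%R by rewrite -[RHS]mulr1 -ee' mulrDr fe' addr0.
have ee : (e * e = e)%R by rewrite -[RHS]mulr1 -ee' mulrDr e_e' addr0.
have cu : coz (f + e')%R = \top.
  apply/le_anti; rewrite lex1 /= -cov leUx; apply/andP; split.
    rewrite -{1}[f](_ : (f + e') * e = f)%R ?coz_mul_le//.
    by rewrite mulrDl fe [(e' * e)%R]mulrC e_e' addr0.
  rewrite -ce' -{1}[e'](_ : (f + e') * e' = e')%R ?coz_mul_le//.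
  by rewrite mulrDl fe' add0r -[RHS]mulr1 -ee' mulrDr [(e' * e)%R]mulrC e_e' add0r.
have [w uw] := coz1_unit cu.
exists e, (e * w)%R; split=> //.
by rewrite mulrA fe -[LHS]mulr1 -uw mulrA mulrDr [(e * f)%R]mulrC fe e_e' addr0.
Qed.

End Idempotents.

(** * Comparison of two functions on a P_F-frame *)

Section Comparison.
Context {d : Order.disp_t} {L : frameType d}.
Implicit Types f g u v alpha : contfun L.

Lemma mul_double_pseudocompl_eq0 alpha f g :
  coz alpha <= pseudocompl (pseudocompl (coz f)) -> (f * g = 0)%R -> (alpha * g = 0)%R.
Proof.
move=> af /mul_eq0_coz/double_pseudocompl_disjoint fg; apply/mul_eq0_coz/eqP.
by rewrite -lex0 -fg leI2.
Qed.

Lemma coz_mul_double_pseudocompl g alpha f :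
  coz alpha <= pseudocompl (pseudocompl (coz f)) ->
  coz (g * alpha)%R <= pseudocompl (pseudocompl (coz (g * f)%R)).
Proof.
move=> af; rewrite !cozM; apply: le_trans (meet_double_pseudocompl _ _).
by rewrite leI2.
Qed.

(** Why a function with complemented cozero element never witnesses the failure of
    the d-ideal property. *)
Lemma complemented_coz_dvd f alpha : complemented (coz f) ->
  coz alpha <= pseudocompl (pseudocompl (coz f)) -> exists h, alpha = (f * h)%R.
Proof.
move=> /complemented_coz_idempotent[e [h [eE fe _]]] af; exists (h * alpha)%R.
have : (alpha * (1 - e) = 0)%R.
  by apply: mul_double_pseudocompl_eq0 af _; rewrite mulrBr mulr1 fe subrr.
by rewrite mulrBr mulr1 => /eqP; rewrite subr_eq0 => /eqP {1}->; rewrite eE; ring.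
Qed.

(** Let [p] be the positive part of [u ^+ 2 - v ^+ 2].  Where [p] is nonzero, [u] is
    nonzero too, in the sense that [u ^+ 2] divides [p ^+ 2]; where [p] vanishes,
    [v ^+ 2] is the maximum of [u ^+ 2] and [v ^+ 2], which divides [u ^+ 4]. *)
Lemma complemented_excess_compare u v :
  complemented (coz (contfun_max (u ^+ 2 - v ^+ 2) 0)%R) ->
  exists e : contfun L, [/\ (e * e = e)%R, exists h, e = (u * h)%R
    & exists k, ((1 - e) * u ^+ 4 = v * k)%R].
Proof.
set p := contfun_max _ _ => /complemented_coz_idempotent[e [h [eE pe ee]]].
have max_dvd : ((v ^+ 2 + p) * contfun_quot (u ^+ 2) (v ^+ 2) = u ^+ 4)%R.
  rewrite /p; pointwise u v v.
  have := mulr_quot (x ^+ 2)%R (y ^+ 2)%R; rewrite (max_l (sqr_ge0 x)) -exprM => <-.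
  by congr (_ * _)%R; case: (leP (x ^+ 2) (y ^+ 2))%R => h0; [rewrite max_r|rewrite max_l]; lra.
have dvd_p : (u ^+ 2 * contfun_quot p (u ^+ 2) = p ^+ 2)%R.
  rewrite /p; pointwise u v v; set m := Num.max _ 0%R.
  have m0 : (0 <= m)%R by rewrite le_max lexx orbT.
  have := mulr_quot m (x ^+ 2)%R; rewrite (max_l m0) => <-; rewrite max_r//.
  by rewrite /m ge_max sqr_ge0 gerBl sqr_ge0.
exists e; split=> //.
  exists (u * contfun_quot p (u ^+ 2) * h ^+ 2)%R.
  by rewrite !mulrA -expr2 dvd_p -[LHS]ee eE; ring.
exists ((1 - e) * v * contfun_quot (u ^+ 2) (v ^+ 2))%R.
have pe' : ((1 - e) * p = 0)%R by rewrite mulrBl mul1r [(e * p)%R]mulrC pe subrr.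
by rewrite -max_dvd mulrA mulrDr pe' addr0; ring.
Qed.

(** The positive parts of [u ^+ 2 - v ^+ 2] and of its opposite have disjoint cozero
    elements.  The squares avoid absolute values; the exponent 4 is
    harmless, as cozero elements ignore powers and roots are available. *)
Lemma P_F_compare u v : P_F_frame L -> exists e : contfun L, (e * e = e)%R /\
  ((exists h, e = (u * h)%R) /\ (exists k, ((1 - e) * u ^+ 4 = v * k)%R) \/
   (exists h, e = (v * h)%R) /\ (exists k, ((1 - e) * v ^+ 4 = u * k)%R)).
Proof.
move=> PF; set p := contfun_max (u ^+ 2 - v ^+ 2)%R 0%R.
set n := contfun_max (v ^+ 2 - u ^+ 2)%R 0%R.
have pn : (p * n = 0)%R.
  rewrite /p /n; pointwise u v v.
  by have [h|h] := leP (x ^+ 2)%R (y ^+ 2)%R;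
    [rewrite (max_r (_ : x ^+ 2 - y ^+ 2 <= 0)%R) ?mul0r|
     rewrite (max_r (_ : y ^+ 2 - x ^+ 2 <= 0)%R) ?mulr0]; lra.
have cozP phi : Coz L (coz phi) by exists phi.
have [] := PF _ _ (cozP p) (cozP n) (proj2 (mul_eq0_coz p n) pn).
  by move=> /complemented_excess_compare[e [ee h k]]; exists e; split=> //; left.
by move=> /complemented_excess_compare[e [ee h k]]; exists e; split=> //; right.
Qed.

End Comparison.

(** * Sums and intersections of ideals *)

Section Ideals.
Context {d : Order.disp_t} {L : frameType d}.
Implicit Types (f g alpha beta e i j : contfun L) (I J : set (contfun L)).

Lemma ideal_mulr (R : comPzRingType) (I : set R) x a : is_ideal I -> I x -> I (x * a)%R.
Proof. by move=> [_ _ h] /(h a); rewrite mulrC. Qed.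

Lemma ideal_add (R : comPzRingType) (I : set R) x y : is_ideal I -> I x -> I y -> I (x + y)%R.
Proof. by move=> [_ h _]; apply: h. Qed.

Lemma is_ideal_sum (R : comPzRingType) (I J : set R) :
  is_ideal I -> is_ideal J -> is_ideal (ideal_sum I J).
Proof.
move=> [I0 ID IM] [J0 JD JM]; split.
- by exists 0%R => //; exists 0%R => //; rewrite addr0.
- move=> _ _ [x Ix [y Jy <-]] [x' Ix' [y' Jy' <-]].
  exists (x + x')%R; first exact: ID.
  by exists (y + y')%R; [apply: JD|rewrite addrACA].
- move=> a _ [x Ix [y Jy <-]]; exists (a * x)%R; first exact: IM.
  by exists (a * y)%R; [apply: JM|rewrite mulrDr].
Qed.

Lemma ideal_sumC (R : comPzRingType) (I J : set R) : ideal_sum I J = ideal_sum J I.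
Proof.
by apply/seteqP; split=> _ [x Ix [y Jy <-]]; exists y => //; exists x; rewrite // addrC.
Qed.

Lemma ideal_by_parts (R : comPzRingType) (I : set R) (e x : R) :
  is_ideal I -> I (e * x)%R -> I ((1 - e) * x)%R -> I x.
Proof.
by move=> II h1 h2; have := ideal_add II h1 h2; rewrite -mulrDl addrC subrK mul1r.
Qed.

Lemma not_d_idealP I : is_ideal I -> ~ d_ideal I ->
  exists alpha f, [/\ I f, coz alpha <= pseudocompl (pseudocompl (coz f)) & ~ I alpha].
Proof.
move=> II nd; apply: contrapT => nex; apply: nd; split=> // alpha f If af.
by apply: contrapT => na; apply: nex; exists alpha, f.
Qed.

Lemma d_ideal_coz I f alpha : d_ideal I -> I f -> coz alpha <= coz f -> I alpha.
Proof.
by move=> [_ h] If af; apply: h If (le_trans af (le_double_pseudocompl _)).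
Qed.

Lemma coz_compare e f g k : ((1 - e) * f ^+ 4 = g * k)%R -> coz ((1 - e) * f)%R <= coz g.
Proof.
move=> h; rewrite -(@cozX _ _ _ 4)// (_ : ((1 - e) * f) ^+ 4 = g * (k * (1 - e) ^+ 3))%R.
  exact: coz_mul_le.
by rewrite mulrA -h; ring.
Qed.

(** Compare the two summands [i] and [j]: a function below the double pseudocomplement
    of [coz (i + j)] splits into a part over the clopen piece on which [i] is a unit
    and a part controlled by [j] alone. *)
Lemma P_F_sum_d_ideal I J : P_F_frame L -> d_ideal I -> d_ideal J -> d_ideal (ideal_sum I J).
Proof.
move=> PF dI dJ.
have half (A B : set (contfun L)) alpha i j e h k : d_ideal A -> d_ideal B -> A i -> B j ->
    coz alpha <= pseudocompl (pseudocompl (coz (i + j)%R)) ->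
    (e = i * h)%R -> ((1 - e) * i ^+ 4 = j * k)%R -> ideal_sum A B alpha.
  move=> [AI _] dB Ai Bj aij eE ek; exists (e * alpha)%R.
    by rewrite eE -mulrA; apply: ideal_mulr.
  exists ((1 - e) * alpha)%R; last by rewrite -mulrDl addrC subrK mul1r.
  case: dB => _; apply; first exact: Bj.
  apply: le_trans (coz_mul_double_pseudocompl (1 - e)%R aij) _.
  apply: double_pseudocompl_mono; rewrite mulrDr; apply: le_trans (cozD _ _) _.
  by rewrite leUx (coz_compare ek) mulrC coz_mul_le.
split; first by apply: is_ideal_sum; [case: dI|case: dJ].
move=> alpha _ [i Ii [j Jj <-]] aij.
have [e [_ [[[h eE] [k ek]]|[[h eE] [k ek]]]]] := P_F_compare i j PF.
  exact: half eE ek.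
by rewrite ideal_sumC; apply: half eE ek => //; rewrite addrC.
Qed.

(** Compare witnesses [f] and [g]: outside the piece on which [f] is a unit,
    [coz f <= coz (f * g)], and [f * g] lies in the intersection. *)
Lemma P_F_intersection_d_ideal I J : P_F_frame L -> is_ideal I -> is_ideal J ->
  d_ideal (I `&` J) -> d_ideal I \/ d_ideal J.
Proof.
move=> PF II JI dIJ; apply: contrapT => /not_orP[nI nJ].
have [alpha [f [If af nIa]]] := not_d_idealP II nI.
have [beta [g [Jg bg nJb]]] := not_d_idealP JI nJ.
have IJfg : (I `&` J) (f * g)%R.
  by split; [apply: ideal_mulr|rewrite mulrC; apply: ideal_mulr].
have half (A : set (contfun L)) x y a e h k : is_ideal A -> I `&` J `<=` A -> A x ->
    coz a <= pseudocompl (pseudocompl (coz x)) -> (I `&` J) (x * y)%R ->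
    (e = x * h)%R -> ((1 - e) * x ^+ 4 = y * k)%R -> A a.
  move=> AI IJA Ax ax xy eE ek; apply: (ideal_by_parts (e := e)) => //.
    by rewrite eE -mulrA; apply: ideal_mulr.
  apply: IJA; case: dIJ => _; apply; first exact: xy.
  apply: le_trans (coz_mul_double_pseudocompl (1 - e)%R ax) _.
  apply: double_pseudocompl_mono; rewrite [coz (x * y)%R]cozM lexI (coz_compare ek) andbT.
  by rewrite mulrC coz_mul_le.
have [e [_ [[[h eE] [k ek]]|[[h eE] [k ek]]]]] := P_F_compare f g PF.
  by apply: nIa; apply: half If af IJfg eE ek => // x [].
by apply: nJb; rewrite mulrC in IJfg; apply: half Jg bg IJfg eE ek => // x [].
Qed.

(** Roots of the witnesses decompose in the sum.  Modulo [I] the function [alpha] is the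
    ninth power of an element of [J], modulo [J] the function [beta] is the ninth power
    of an element of [I]; comparing these two elements absorbs [alpha] into [I] on one
    clopen piece and [beta] into [J] on the other.  On the remaining pieces the witnesses
    [f] and [g] have disjoint cozero elements, one of which is complemented. *)
Lemma P_F_summand_d_ideal I J : P_F_frame L -> is_ideal I -> is_ideal J ->
  d_ideal (ideal_sum I J) -> d_ideal I \/ d_ideal J.
Proof.
move=> PF II JI dS; apply: contrapT => /not_orP[nI nJ].
have [alpha [f [If af nIa]]] := not_d_idealP II nI.
have [beta [g [Jg bg nJb]]] := not_d_idealP JI nJ.
have [I0 _ _] := II; have [J0 _ _] := JI.
have SI x : I x -> ideal_sum I J x by move=> Ix; exists x => //; exists 0%R; rewrite // addr0.
have SJ x : J x -> ideal_sum I J x by move=> Jx; exists 0%R => //; exists x; rewrite // add0r.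
have ninth_power x y : ideal_sum I J y -> coz x <= pseudocompl (pseudocompl (coz y)) ->
    exists i j, [/\ I i, J j & x = (i + j) ^+ 9]%R.
  move=> Sy xy; have [s sx] := cube_root x; have [t ts] := cube_root s.
  have St : ideal_sum I J t.
    by case: dS => _; apply; [exact: Sy|rewrite -(@cozX _ _ t 3)// ts -(@cozX _ _ s 3)// sx].
  by case: St => i Ii [j Jj ijt]; exists i, j; rewrite ijt -sx -ts -exprM.
have [i1 [j1 [Ii1 Jj1 alphaE]]] := ninth_power alpha f (SI _ If) af.
have [i2 [j2 [Ii2 Jj2 betaE]]] := ninth_power beta g (SJ _ Jg) bg.
(* The remaining parts [e * a] and [(1 - e) * b] are governed by [e * x] and
   [(1 - e) * y], whose product is 0. *)
have separate (A B : set (contfun L)) a x b y e :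
    is_ideal A -> is_ideal B -> (e * e = e)%R -> A x -> B y ->
    coz a <= pseudocompl (pseudocompl (coz x)) -> coz b <= pseudocompl (pseudocompl (coz y)) ->
    A ((1 - e) * a)%R -> B (e * b)%R -> A a \/ B b.
  move=> AI BI ee Ax By ax byy Aa Bb.
  have disj : ((e * x) * ((1 - e) * y) = 0)%R.
    by rewrite mulrACA mulrBr mulr1 ee subrr mul0r.
  have [|||c|c] := PF (coz (e * x)%R) (coz ((1 - e) * y)%R).
  - by exists (e * x)%R.
  - by exists ((1 - e) * y)%R.
  - exact/mul_eq0_coz.
  - left; apply: (ideal_by_parts (e := e)) => //.
    have [h ->] := complemented_coz_dvd c (coz_mul_double_pseudocompl e ax).
    by rewrite mulrAC mulrC; apply: ideal_mulr.
  - right; apply: (ideal_by_parts (e := e)) => //.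
    have [h ->] := complemented_coz_dvd c (coz_mul_double_pseudocompl (1 - e)%R byy).
    by rewrite mulrAC mulrC; apply: ideal_mulr.
have absorbed (A B : set (contfun L)) a x y z e h k : is_ideal A -> is_ideal B ->
    A x -> B y -> A z -> (a = (x + y) ^+ 9)%R ->
    (e = y * h)%R -> ((1 - e) * y ^+ 4 = z * k)%R ->
    A ((1 - e) * a)%R.
  move=> AI BI Ax By Az -> eE ek.
  (* [(x + y) ^+ 9 - y ^+ 9] is a multiple of [x], as a difference of cubes of cubes. *)
  pose c := ((x + y) ^+ 2 + (x + y) * y + y ^+ 2)%R.
  have -> : ((1 - e) * (x + y) ^+ 9 = x * ((1 - e) * c * ((x + y) ^+ 6 + (x + y) ^+ 3 * y ^+ 3 + y ^+ 6))
      + ((1 - e) * y ^+ 4) * y ^+ 5)%R by rewrite /c; ring.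
  by rewrite ek; apply: ideal_add => //; do ?apply: ideal_mulr.
have [e [ee [[[h eE] [k ek]]|[[h eE] [k ek]]]]] := P_F_compare j1 i2 PF.
  have [||//|//] := separate I J alpha f beta g e II JI ee If Jg af bg.
    exact: absorbed II JI Ii1 Jj1 Ii2 alphaE eE ek.
  by rewrite eE -mulrA; apply: ideal_mulr.
have [||//|//] := separate J I beta g alpha f e JI II ee Jg If bg af.
  by apply: absorbed JI II Jj2 Ii2 Jj1 _ eE ek; rewrite addrC.
by rewrite eE -mulrA; apply: ideal_mulr.
Qed.


(** The cube root [t] of [f] lies in [I], so [t ^+ 2 = t * f * y = t ^+ 4 * y] for some
    [y]; hence [t] is annihilated by [1 - t ^+ 2 * y], whose cozero element is the
    complement sought. *)
Lemma principal_plus_d_ideal I f : d_ideal I -> I f ->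
  (forall x, I x -> exists y k, (x = f * y + k)%R /\ (f * k = 0)%R) -> complemented (coz f).
Proof.
move=> dI If form; have [t tf] := cube_root f.
have ct : coz t = coz f by rewrite -tf cozX.
have [|y [k [tE fk]]] := form t; first by apply: d_ideal_coz dI If _; rewrite ct.
have tk : (t * k = 0)%R by apply/mul_eq0_coz; rewrite ct; apply/mul_eq0_coz.
have tt : (t * (t * (1 - t ^+ 2 * y)) = 0)%R.
  have : (t * t = t * (f * y))%R by rewrite {2}tE mulrDr tk addr0.
  have -> : (t * (t * (1 - t ^+ 2 * y)) = t * t - t * (t ^+ 3 * y))%R by ring.
  by rewrite tf => ->; rewrite subrr.
apply/complementedP; exists (coz (1 - t ^+ 2 * y)%R).
  rewrite -ct; apply/eqP; rewrite -[coz t]meetxx -meetA.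
  by rewrite -[X in _ `&` X]cozM -cozM tt coz0.
apply/le_anti; rewrite lex1 /=.
have := cozD (t ^+ 2 * y)%R (1 - t ^+ 2 * y)%R; rewrite addrC subrK coz1 => /le_trans.
apply; apply: leU2 (lexx _).
by apply: le_trans (coz_mul_le _ _) _; rewrite cozX// ct.
Qed.


Lemma is_ideal_principal (R : comPzRingType) (a : R) :
  is_ideal [set (a * x)%R | x in [set: R]].
Proof.
split.
- by exists 0%R; rewrite ?mulr0.
- by move=> _ _ [x _ <-] [y _ <-]; exists (x + y)%R; rewrite ?mulrDr.
- by move=> b _ [x _ <-]; exists (b * x)%R; rewrite // mulrCA.
Qed.

Definition double_annihilator f : set (contfun L) :=
  [set alpha | coz alpha <= pseudocompl (pseudocompl (coz f))].

Lemma d_ideal_double_annihilator f : d_ideal (double_annihilator f).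
Proof.
split=> [|alpha g gf ag]; last first.
  by apply: le_trans ag _; rewrite -[leRHS]double_pseudocomplK double_pseudocompl_mono.
split=> [|x y xf yf|a x xf]; rewrite /double_annihilator /=.
- by rewrite coz0 le0x.
- by apply: le_trans (cozD _ _) _; rewrite leUx xf.
- by apply: le_trans xf; rewrite mulrC coz_mul_le.
Qed.

(** The sum of [f] and the positive part of [q - f] is the maximum of [q] and [f],
    which divides the unit [q ^+ 2]. *)
Lemma coz_cst_max (q : rat) f : (0 < q)%R ->
  coz f `|` coz (contfun_max (contfun_cst q - f) 0)%R = \top.
Proof.
move=> q0; set p := contfun_max _ _.
have qE : ((f + p) * contfun_quot (contfun_cst q) f = contfun_cst q ^+ 2)%R.
  rewrite /p; pointwise f f f.
  have := mulr_quot q x; rewrite (max_l (ltW q0)) => <-; congr (_ * _)%R.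
  by case: (leP q x) => h; [rewrite max_r|rewrite max_l]; lra.
apply/le_anti; rewrite lex1 /= -(@coz_cst _ _ q) ?gt_eqF// -(@cozX _ _ _ 2)// -qE.
exact: le_trans (coz_mul_le _ _) (cozD _ _).
Qed.

(** If [f ^+ 2 <= q] for all [q > 0], then [f ^+ 2] takes no value in an interval
    [(r', s')] with [r' > 0], as it is at most [q = r' / 2]. *)
Lemma square_level f : f <> 0%R ->
  exists2 q : rat, (0 < q)%R & contfun_max (f ^+ 2 - contfun_cst q)%R 0%R <> 0%R.
Proof.
move=> f0; apply: contrapT => nex; apply: f0; apply: coz_eq0; rewrite -(@cozX _ _ f 2)//.
have below (q : rat) : (0 < q)%R -> contfun_max (f ^+ 2)%R (contfun_cst q) = contfun_cst q.
  move=> q0; have e0 : contfun_max (f ^+ 2 - contfun_cst q)%R 0%R = 0%R.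
    by apply: contrapT => h; apply: nex; exists q.
  rewrite -[RHS]addr0 -e0; pointwise f f f.
  by case: (leP (x ^+ 2)%R q) => h; [rewrite max_r|rewrite max_l]; lra.
apply/eqP; rewrite -lex0; apply: coz_le => r s /orP[s0|r0]; first by rewrite square_ge0.
rewrite -[leLHS]meet1x; apply: contfun_inner => r' s' rr' r's' ss'; rewrite meet1x.
have r'0 : (0 < r')%R := le_lt_trans r0 rr'.
have box : box_sub Num.max r' s' 0%R r' r' s'.
  move=> x y /andP[rx xs] /andP[y0 yr].
  by rewrite max_l ?rx//; apply: ltW; apply: lt_trans yr rx.
have := contfun_op_ub (f ^+ 2)%R (contfun_cst (r' / 2)) box.
rewrite -(rliftE (contfun_op_relations _ _ good_max)) -/(contfun_max _ _) below ?divr_gt0//.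
have half : (0 < r' / 2 < r')%R by apply/andP; split; clear -r'0; lra.
rewrite !contfun_cstE half meetx1 ifN//; apply/negP => /andP[h _].
by move: half; rewrite [X in _ && X]ltNge (ltW h) andbF.
Qed.

(** [f1] is the product of [f] and the positive part of [q - f ^+ 2].  The latter is
    nonzero wherever [f] vanishes, so truncation does not change [f] near its zeros, and
    a complement of [coz f1] can be cut down to a complement of [coz f]. *)
Lemma truncated_square f (q : rat) : (0 < q)%R ->
  let k := contfun_max (f ^+ 2 - contfun_cst q)%R 0%R in
  exists f1, [/\ (f1 * k = 0)%R, coz k <= coz f, coz f1 <= coz f
    & complemented (coz f1) -> complemented (coz f)].
Proof.
move=> q0 k; pose p := contfun_max (contfun_cst q - f ^+ 2)%R 0%R.
exists (f * p)%R; split.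
- rewrite -mulrA (_ : p * k = 0)%R ?mulr0// /p /k; pointwise f f f.
  by have [h|h] := leP (x ^+ 2)%R q;
    [rewrite [X in (_ * X)%R]max_r ?mulr0|rewrite [X in (X * _)%R]max_r ?mul0r]; lra.
- have e : (f ^+ 2 * contfun_quot k (f ^+ 2) = k ^+ 2)%R.
    rewrite /k; pointwise f f f; set m := Num.max _ 0%R.
    have m0 : (0 <= m)%R by rewrite le_max lexx orbT.
    have := mulr_quot m (x ^+ 2)%R; rewrite (max_l m0) => <-; rewrite max_r//.
    by rewrite /m ge_max sqr_ge0 gerBl ltW.
  by rewrite -(@cozX _ _ k 2)// -e expr2 -mulrA coz_mul_le.
- exact: coz_mul_le.
- move=> /complementedP[c disj cov]; apply/complementedP; exists (c `&` coz p).
    by rewrite meetCA -cozM meetC disj.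
  have fp : coz f `|` coz p = \top by rewrite -(@cozX _ _ f 2)// coz_cst_max.
  apply/le_anti; rewrite lex1 /=; apply: (le_by_cases cov); rewrite meetx1.
    by apply: lexUl; apply: coz_mul_le.
  by rewrite -[leLHS]meetx1 -fp frame_meetUr leUx leUr andbT lexUl// leIr.
Qed.

(** The principal ideals of two functions with disjoint cozero elements meet in 0. *)
Lemma P_F_of_intersections :
  (forall I J, is_ideal I -> is_ideal J -> d_ideal (I `&` J) -> d_ideal I \/ d_ideal J) ->
  P_F_frame L.
Proof.
move=> H _ _ [f _ <-] [g _ <-] fg.
have prin (a : contfun L) : d_ideal [set (a * x)%R | x in [set: contfun L]] ->
    complemented (coz a).
  move=> dI; apply: principal_plus_d_ideal dI _ _; first by exists 1%R; rewrite ?mulr1.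
  by move=> _ [x _ <-]; exists x, 0%R; rewrite addr0 mulr0.
have inter : [set (f * x)%R | x in [set: contfun L]] `&` [set (g * x)%R | x in [set: contfun L]]
    = double_annihilator 0%R.
  apply/seteqP; split=> [_ [[x _ <-] [y _ e]]|x]; last first.
    rewrite /double_annihilator /= coz0 => x0.
    suff -> : x = 0%R by split; exists 0%R; rewrite ?mulr0.
    apply: coz_eq0; apply/eqP; rewrite -lex0 -(complemented_double_pseudocompl complemented_bot).
    exact: x0.
  rewrite /double_annihilator /=; apply: le_trans (le0x _).
  by rewrite -fg lexI -{2}e !coz_mul_le.
have dI := d_ideal_double_annihilator 0%R; rewrite -inter in dI.
have [/prin|/prin] := H _ _ (is_ideal_principal f) (is_ideal_principal g) dI; first by left.
by right.
Qed.

(** Truncating [f] leaves room for a nonzero [k] annihilated by both double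
    annihilators [A] and [B], so that their sum is proper and hence a d-ideal. *)
Lemma P_F_of_sums :
  (forall I J, d_ideal I -> d_ideal J ->
     d_ideal (ideal_sum I J) \/ ideal_sum I J = [set: contfun L]) ->
  (forall I J, is_ideal I -> is_ideal J -> d_ideal (ideal_sum I J) ->
     ideal_sum I J <> [set: contfun L] -> d_ideal I \/ d_ideal J) ->
  P_F_frame L.
Proof.
move=> H1 H2 _ _ [f _ <-] [g _ <-] fg; have [f0|f0] := pselect (f = 0%R).
  by left; rewrite f0 coz0; apply: complemented_bot.
have [q q0 k0] := square_level f0; have [f1 []] := truncated_square f q0.
set k := contfun_max _ _ in k0 * => f1k kf f1f f1_compl.
have ann_g (x : contfun L) : coz x <= coz f -> (x * g = 0)%R.
  by move=> xf; apply/mul_eq0_coz/eqP; rewrite -lex0 -fg leI2.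
have f1g := ann_g _ f1f; have kg := ann_g _ kf.
pose A := double_annihilator f1; pose B := double_annihilator g.
have [dA dB] : d_ideal A /\ d_ideal B by split; apply: d_ideal_double_annihilator.
pose prin (a : contfun L) := [set (a * x)%R | x in [set: contfun L]].
have proper : ideal_sum A B <> [set: contfun L].
  move=> full; apply: k0; rewrite -[LHS]mul1r.
  have : ideal_sum A B 1%R by rewrite full.
  case=> a Aa [b Bb <-]; rewrite mulrDl.
  rewrite (mul_double_pseudocompl_eq0 Aa f1k) add0r.
  by apply: mul_double_pseudocompl_eq0 Bb _; rewrite mulrC.
have dAB : d_ideal (ideal_sum A B) by case: (H1 A B dA dB).
pose I := ideal_sum (prin f1) B; pose J := ideal_sum (prin g) A.
have prinA x : A (f1 * x)%R by apply: le_trans (coz_mul_le _ _) (le_double_pseudocompl _).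
have prinB x : B (g * x)%R by apply: le_trans (coz_mul_le _ _) (le_double_pseudocompl _).
have IJ : ideal_sum I J = ideal_sum A B.
  apply/seteqP; split=> [_ [_ [_ [x _ <-] [b Bb <-]] [_ [_ [y _ <-] [a Aa <-]] <-]]|].
    exists (f1 * x + a)%R; first by apply: ideal_add => //; case: dA.
    exists (b + g * y)%R; first by apply: ideal_add => //; case: dB.
    by ring.
  move=> _ [a Aa [b Bb <-]]; exists b.
    by exists 0%R; [exists 0%R; rewrite ?mulr0|exists b; rewrite ?add0r].
  exists a; last by rewrite addrC.
  by exists 0%R; [exists 0%R; rewrite ?mulr0|exists a; rewrite ?add0r].
have idI : is_ideal I by apply: is_ideal_sum; [apply: is_ideal_principal|case: dB].
have idJ : is_ideal J by apply: is_ideal_sum; [apply: is_ideal_principal|case: dA].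
have regular (a b : contfun L) : (a * b = 0)%R ->
    d_ideal (ideal_sum (prin a) (double_annihilator b)) -> complemented (coz a).
  move=> ab dK; apply: principal_plus_d_ideal dK _ _.
    exists a; first by exists 1%R; rewrite ?mulr1.
    by exists 0%R; rewrite ?addr0// /double_annihilator /= coz0 le0x.
  move=> _ [_ [x _ <-] [y By <-]]; exists x, y; split=> //.
  by rewrite mulrC; apply: mul_double_pseudocompl_eq0 By _; rewrite mulrC.
have [||/(regular _ _ f1g)/f1_compl|] := H2 I J idI idJ; rewrite ?IJ//; first by left.
by rewrite mulrC in f1g; move=> /(regular _ _ f1g); right.
Qed.

End Ideals.

Theorem corollary5p5 (d : Order.disp_t) (L : frameType d)
    (L_cr : completely_regular L) :
  (((forall I J : set (contfun L), d_ideal I -> d_ideal J ->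
       d_ideal (ideal_sum I J) \/ ideal_sum I J = [set: contfun L]%classic)
    /\
    (forall I J : set (contfun L), is_ideal I -> is_ideal J ->
       d_ideal (ideal_sum I J) -> ideal_sum I J <> [set: contfun L]%classic ->
       d_ideal I \/ d_ideal J))
   <-> P_F_frame L)
  /\
  (P_F_frame L <->
   (forall I J : set (contfun L), is_ideal I -> is_ideal J ->
      d_ideal (I `&` J)%classic -> d_ideal I \/ d_ideal J)).
Proof.
split; split.
- by case; apply: P_F_of_sums.
- move=> PF; split=> [I J dI dJ|I J II JI dIJ _]; first by left; apply: P_F_sum_d_ideal.
  exact: P_F_summand_d_ideal.
- by move=> PF I J; apply: P_F_intersection_d_ideal.
- exact: P_F_of_intersections.
Qed.
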